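(* Let $I$ and $J$ be sets and let $f: I\times J\to\mathbb{C}$ be bounded. The following are equivalent: (i) (Fubini-like property) For every mean $M$ on $\ell^\infty(I)$ and every mean $N$ on $\ell^\infty(J)$, the two iterated ''integrals'' of $f$ coincide: $$N\bigl(j\mapsto M(f(\bullet,j))\bigr)=M\bigl(i\mapsto N(f(i,\bullet))\bigr).$$ (ii) There exist compact convex subsets $\widetilde I$ and $\widetilde J$ of Hausdorff locally convex topological linear spaces, embeddings of sets (injective maps) $I\hookrightarrow\widetilde I$ and $J\hookrightarrow\widetilde J$, and a function $\widetilde f:\widetilde I\times\widetilde J\to\mathbb{C}$ which is separately continuous and separately affine and which extends $f$ (i.e. its restriction to $I\times J$, via the embeddings, is $f$). (iii) The set of rows $\{f(i,\bullet): i\in I\}$ is relatively weakly compact in $\ell^\infty(J)$. (iv) The set of columns $\{f(\bullet,j): j\in J\}$ is relatively weakly compact in $\ell^\infty(I)$.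
   Context: For a set $K$, $\ell^\infty(K)$ is the Banach space of bounded complex functions on $K$ with the sup norm. A mean on $\ell^\infty(K)$ is a positive linear functional on $\ell^\infty(K)$ mapping the constant function $1$ to $1$ (equivalently, a finitely additive probability ''measure'' on $K$). A subset of a Banach space is relatively weakly compact if its closure in the weak topology is weakly compact. A function of two variables is separately continuous (separately affine) if it is continuous (affine) in each variable when the other is fixed. *)

(* Defs.v *)
From HB Require Import structures.
From mathcomp Require Import all_boot all_order all_algebra.
From mathcomp Require Import complex.
From mathcomp Require Import all_classical all_reals all_analysis.

Set Implicit Arguments.
Unset Strict Implicit.
Unset Printing Implicit Defensive.

Import Order.TTheory GRing.Theory Num.Theory.
Import numFieldNormedType.Exports.

Local Open Scope classical_set_scope.
Local Open Scope ring_scope.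
Local Open Scope complex_scope.

(* R[i] with the topology of the modulus. *)
HB.instance Definition _ (R : realType) := NormedModule.copy R[i] R[i]^o.

Lemma bounded_complexP (R : realType) (K : Type) (u : K -> R[i]) :
  bounded_fun u <-> exists c : R, forall x, `|u x| <= c%:C.
Proof.
split=> [[M [MR Mu]]|[c uc]].
  exists (complex.Re M + 1) => x.
  by rewrite rmorphD/= RRe_real// (Mu (M + 1)) ?ltrDl.
exists c%:C; split=> [|M cM x _ /=]; first by apply/complex_realP; exists c.
by rewrite (le_trans (uc x))// ltW.
Qed.

Section linfty_lmodType.
Variables (R : realType) (K : Type).

Definition bounded_pred : {pred (K -> R[i])} := fun u => `[< bounded_fun u >].

Record linfty := Linfty {
  linfty_fun :> K -> R[i];
  linfty_subproof : linfty_fun \in bounded_pred }.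

HB.instance Definition _ := [isSub for linfty_fun].
HB.instance Definition _ := [Choice of linfty by <:].

Lemma bounded_pred_submod : submod_closed bounded_pred.
Proof.
split.
  by apply/asboolP/bounded_complexP; exists 0 => x; rewrite normr0.
move=> a u v /asboolP/bounded_complexP[c uc] /asboolP/bounded_complexP[d vd].
apply/asboolP/bounded_complexP; exists (Normc.normc a * c + d) => x.
rewrite rmorphD rmorphM (le_trans (ler_normD _ _))// lerD//.
rewrite normrM; apply: ler_wpM2l; [exact: normr_ge0|exact: uc].
Qed.

HB.instance Definition _ := GRing.isSubmodClosed.Build R[i] (K -> R[i])
  bounded_pred bounded_pred_submod.
HB.instance Definition _ := [SubChoice_isSubLmodule of linfty by <:].

Definition to_linfty (u : K -> R[i]) (hu : bounded_fun u) : linfty :=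
  Linfty (asboolT hu : u \in bounded_pred).

(* The scalars being R[i], the norm is R[i]-valued; the supremum over an empty
   K is 0. *)
Definition linfty_norm (u : linfty) : R[i] :=
  (sup (range (fun x => Normc.normc (u x))))%:C.

Lemma linfty_norm_ub (u : linfty) x : `|u x| <= linfty_norm u.
Proof.
rewrite lecR; apply: ub_le_sup; last by exists x.
have /asboolP/bounded_complexP[c uc] := linfty_subproof u.
by exists c => _ [y _ <-]; rewrite -lecR; exact: uc.
Qed.

Lemma linfty_norm_ge0 (u : linfty) : 0 <= linfty_norm u.
Proof.
rewrite /linfty_norm.
have [->|/set0P[_ [x _ _]]] := eqVneq (range (fun x => Normc.normc (u x))) set0.
  by rewrite sup0.
exact: le_trans (linfty_norm_ub u x).
Qed.

Lemma linfty_norm_le (u : linfty) (c : R[i]) :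
  0 <= c -> (forall x, `|u x| <= c) -> linfty_norm u <= c.
Proof.
move=> c0 uc; have /complex_realP[r cr] := ger0_real c0.
move: c0 uc; rewrite {}cr ler0c lecR => r0 uc.
have [->|/set0P ne] := eqVneq (range (fun x => Normc.normc (u x))) set0.
  by rewrite sup0.
by apply: ge_sup => // _ [x _ <-]; rewrite -lecR; exact: uc.
Qed.

Lemma linfty_normD (u v : linfty) :
  linfty_norm (u + v) <= linfty_norm u + linfty_norm v.
Proof.
apply: linfty_norm_le; first by rewrite addr_ge0// linfty_norm_ge0.
by move=> x; rewrite (le_trans (ler_normD _ _))// lerD// linfty_norm_ub.
Qed.

Lemma normZ_le (a : R[i]) (u : linfty) :
  linfty_norm (a *: u) <= `|a| * linfty_norm u.
Proof.
apply: linfty_norm_le; first by rewrite mulr_ge0// linfty_norm_ge0.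
by move=> x; rewrite normrM ler_wpM2l// linfty_norm_ub.
Qed.

Lemma linfty_normZ (a : R[i]) (u : linfty) :
  linfty_norm (a *: u) = `|a| * linfty_norm u.
Proof.
apply/le_anti; rewrite normZ_le/=.
have [->|a0] := eqVneq a 0.
  by rewrite normr0 mul0r linfty_norm_ge0.
rewrite -ler_pdivlMl ?normr_gt0// -normfV.
by rewrite -{1}[u]scale1r -(mulVf a0) -scalerA normZ_le.
Qed.

Lemma linfty_norm_eq0 (u : linfty) : linfty_norm u = 0 -> u = 0.
Proof.
move=> u0; apply/val_inj/funext => x; apply/eqP.
by rewrite -normr_le0 -u0 linfty_norm_ub.
Qed.

HB.instance Definition _ := Lmodule_isNormed.Build R[i] linfty
  linfty_normD linfty_normZ linfty_norm_eq0.

Lemma bounded_cst (c : R[i]) : bounded_fun (fun _ : K => c).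
Proof.
by apply/bounded_complexP; exists (Normc.normc c) => x; exact: lexx.
Qed.

(* Positivity refers to the order of R[i], in which 0 <= z means that z is a
   nonnegative real. *)
Record mean := Mean {
  mean_fun :> {scalar linfty};
  mean_ge0 : forall u : linfty, (forall x, 0 <= u x) -> 0 <= mean_fun u;
  mean1 : mean_fun (to_linfty (bounded_cst 1)) = 1 }.

Lemma mean_real_le (M : mean) (u : linfty) (c : R) :
  (forall x, u x \is Num.real) -> (forall x, `|u x| <= c%:C) -> `|M u| <= c%:C.
Proof.
move=> ur uc; have M1 := mean1 M; set e := to_linfty _ in M1.
have Mc : M (c%:C *: e) = c%:C by rewrite linearZ/= M1 mulr1.
have eE x : (c%:C *: e) x = c%:C by rewrite -[RHS]mulr1.
have H1 : 0 <= M (c%:C *: e - u).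
  apply: mean_ge0 => x; have := uc x; rewrite real_ler_norml// => /andP[_].
  by rewrite -subr_ge0 -{1}(eE x).
have H2 : 0 <= M (c%:C *: e + u).
  apply: mean_ge0 => x; have := uc x; rewrite real_ler_norml// => /andP[+ _].
  by rewrite -subr_ge0 opprK addrC -{1}(eE x).
rewrite linearB Mc in H1; rewrite linearD Mc in H2.
have cR : c%:C \is Num.real by apply/complex_realP; exists c.
have MR : M u \is Num.real.
  by rewrite -(subKr c%:C (M u)) realB ?(ger0_real H1).
rewrite real_ler_norml// -[in X in _ && X]subr_ge0 H1 andbT.
by rewrite -subr_ge0 opprK addrC.
Qed.

Lemma norm_real_complex (a : R) : `|a%:C| = `|a|%:C.
Proof. by rewrite normc_def/= expr0n/= addr0 sqrtr_sqr. Qed.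

Lemma mean_bounded (M : mean) (u : linfty) (c : R) :
  (forall x, `|u x| <= c%:C) -> `|M u| <= (c + c)%:C.
Proof.
move=> uc.
have ha x : `|(complex.Re (u x))%:C| <= c%:C.
  by rewrite norm_real_complex (le_trans (normc_ge_Re _)).
have hb x : `|(complex.Im (u x))%:C| <= c%:C.
  rewrite norm_real_complex -normrN -ReiNIm (le_trans (normc_ge_Re _))//.
  by rewrite normrM [X in _ * X]normc_def/= expr0n/= add0r expr1n sqrtr1 mulr1.
have ba : bounded_fun (fun x => (complex.Re (u x))%:C).
  by apply/bounded_complexP; exists c.
have bb : bounded_fun (fun x => (complex.Im (u x))%:C).
  by apply/bounded_complexP; exists c.
have -> : u = to_linfty ba + 'i%C *: to_linfty bb.
  by apply/val_inj/funext => x; rewrite [LHS]complexE.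
rewrite linearD linearZ/= (le_trans (ler_normD _ _))// rmorphD lerD//.
  by apply: mean_real_le => // x; apply/complex_realP; eexists.
rewrite normrM [X in X * _]normc_def/= expr0n/= add0r expr1n sqrtr1 mul1r.
by apply: mean_real_le => // x; apply/complex_realP; eexists.
Qed.

End linfty_lmodType.

Arguments mean : clear implicits.
Arguments linfty : clear implicits.

(* V with its weak topology, the coarsest topology making every norm-continuous
   linear form continuous. *)
Definition weak (K : numFieldType) (V : normedModType K) : Type :=
  sup_topology (fun phi : {phi : {scalar V} | continuous phi} =>
    Topological.on (initial_topology (sval phi : V -> K))).

HB.instance Definition _ (K : numFieldType) (V : normedModType K) :=
  Topological.on (weak V).

Definition relatively_weakly_compact (K : numFieldType) (V : normedModType K)
  (A : set V) : Prop := compact (closure (A : set (weak V))).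

Section rows_and_columns.
Variables (R : realType) (I J : Type) (f : I * J -> R[i]).
Hypothesis hf : bounded_fun f.

Lemma bounded_fun_row i : bounded_fun (fun j => f (i, j)).
Proof.
have [c fc] := (bounded_complexP f).1 hf.
by apply/bounded_complexP; exists c.
Qed.

Lemma bounded_fun_col j : bounded_fun (fun i => f (i, j)).
Proof.
have [c fc] := (bounded_complexP f).1 hf.
by apply/bounded_complexP; exists c.
Qed.

Definition linfty_row (i : I) : linfty R J := to_linfty (bounded_fun_row i).

Definition linfty_col (j : J) : linfty R I := to_linfty (bounded_fun_col j).

Lemma bounded_mean_col (M : mean R I) : bounded_fun (fun j => M (linfty_col j)).
Proof.
have [c fc] := (bounded_complexP f).1 hf.
apply/bounded_complexP; exists (c + c) => j.
by apply: mean_bounded => x; exact: fc.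
Qed.

Lemma bounded_mean_row (N : mean R J) : bounded_fun (fun i => N (linfty_row i)).
Proof.
have [c fc] := (bounded_complexP f).1 hf.
apply/bounded_complexP; exists (c + c) => i.
by apply: mean_bounded => x; exact: fc.
Qed.

Definition mean_col (M : mean R I) : linfty R J :=
  to_linfty (bounded_mean_col M).

Definition mean_row (N : mean R J) : linfty R I :=
  to_linfty (bounded_mean_row N).

End rows_and_columns.

Definition affine_on (R : realType) (E : tvsType R)
    (A : set E) (g : E -> R[i]) : Prop :=
  forall (t : R) (x y : E), 0 <= t <= 1 -> A x -> A y ->
    g (t *: x + (1 - t) *: y) = t%:C * g x + (1 - t)%:C * g y.

(* A function on a product A * B of subsets of E and F is represented by a total
   function on E * F, of which only the restriction to A * B is constrained. *)
Definition separately_continuous_on (R : realType) (E F : tvsType R)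
    (A : set E) (B : set F) (g : E * F -> R[i]) : Prop :=
  (forall y, B y -> {within A, continuous (fun x => g (x, y))}) /\
  (forall x, A x -> {within B, continuous (fun y => g (x, y))}).

Definition separately_affine_on (R : realType) (E F : tvsType R)
    (A : set E) (B : set F) (g : E * F -> R[i]) : Prop :=
  (forall y, B y -> affine_on A (fun x => g (x, y))) /\
  (forall x, A x -> affine_on B (fun y => g (x, y))).

(* Main.v *)
(* (i) => (ii): let the means on I and on J, with the topology of pointwise
   convergence, play the roles of the two compact convex sets, with
   (M, N) |-> N (j |-> M f(., j)) as extension; its continuity in M is what the
   exchange of M and N provides.

   (ii) => (iii): a bounded functional psi on l^oo(J) is a pointwise limit of
   combinations of evaluations of bounded total mass.  A nonnegative combination
   of the points b j is a multiple of a point of B, so on the slices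
   r_x := g(x, b .), by affinity and compactness of B, psi(r_x) is a signed sum
   of finitely many t g(x, y) with y in B.  Hence x |-> r_x is weakly continuous
   on A, and its image is a weakly compact set that contains the rows.

   (iii) => (i): suppose M and N do not commute on f.  Approximating N by
   combinations nu of evaluations, the functions nu f - N f on I are small on
   any prescribed finite set, while their means under M stay away from 0.  As
   sets of M-content bounded below cannot be almost disjoint, one can extract
   nu_k and i_m such that theta_k := nu_k - N is large on row i_m for k <= m and
   small for m < k.  A weak cluster point r of the rows i_m and an ultrafilter
   limit theta of the theta_k are then contradictory: theta(r) is both large and
   small.

   Condition (i) is symmetric, so (iii) <=> (iv) follows by transposing f. *)

Require Import Defs.
From HB Require Import structures.
From mathcomp Require Import all_boot all_order all_algebra.
From mathcomp Require Import finmap complex ring lra.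
From mathcomp Require Import all_classical all_reals all_analysis.

Set Implicit Arguments.
Unset Strict Implicit.
Unset Printing Implicit Defensive.

Import Order.TTheory GRing.Theory Num.Theory.
Import numFieldNormedType.Exports.

Local Open Scope classical_set_scope.
Local Open Scope ring_scope.

(** * Limits and weak limits *)

Lemma cvg_initial (S : choiceType) (T : topologicalType) (f : S -> T)
    (F : set_system S) (s : S) : Filter F ->
  F --> (s : initial_topology f) <-> f @ F --> f s.
Proof.
move=> FF; split=> [Fs|Fs]; last first.
  move=> U [_ [[W oW <-] /= Wfs]] /filterS; apply.
  exact/Fs/open_nbhs_nbhs.
exact: cvg_trans (cvg_app f Fs) (@initial_continuous _ _ f s).
Qed.

Lemma cvg_weak (K : numFieldType) (V : normedModType K) (F : set_system V)
    (v : V) : Filter F ->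
  F --> (v : weak V) <->
  (forall phi : {scalar V}, continuous phi -> phi @ F --> phi v).
Proof.
move=> FF; split=> [Fv phi phic|Fv].
  have /cvg_sup/(_ (exist _ phi phic)) := Fv.
  by move/cvg_initial; exact.
apply/cvg_sup => -[phi phic]; exact/cvg_initial/Fv.
Qed.

Section complex_limits.
Variable R : realType.
Local Open Scope complex_scope.

Lemma continuous_real_complex : continuous (fun x : R => x%:C).
Proof.
move=> x; apply/cvgrPdist_lt => e e0.
have eR : (complex.Re e)%:C = e by rewrite RRe_real// gtr0_real.
have e0' : 0 < complex.Re e by rewrite -ltcR eR.
near=> y; rewrite -rmorphB norm_real_complex -eR ltcR.
by near: y; exact: cvgr_dist_lt.
Unshelve. all: by end_near. Qed.

Lemma normci : `|'i%C| = 1 :> R[i].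
Proof. by rewrite normc_def/= expr0n/= add0r expr1n sqrtr1. Qed.

Lemma ImE_Re (z : R[i]) : complex.Im z = complex.Re (- 'i%C * z).
Proof. by case: z => p q /=; rewrite oppr0 mul0r mulN1r sub0r opprK. Qed.

Lemma continuous_Re : continuous (@complex.Re R : R[i] -> R).
Proof.
move=> z; apply/(@cvgrPdist_lt _ _ _ (nbhs z) (nbhs_filter z)) => e e0.
exists e%:C; first by rewrite /= ltcR.
by move=> w /= zw; rewrite -ltcR -raddfB (le_lt_trans (normc_ge_Re _)).
Qed.

Lemma normc_ge_Im (z : R[i]) : `|complex.Im z|%:C <= `|z|.
Proof.
rewrite -normrN -ReiNIm (le_trans (normc_ge_Re _))//.
by rewrite normrM normci mulr1.
Qed.

Lemma continuous_Im : continuous (@complex.Im R : R[i] -> R).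
Proof.
move=> z; apply/(@cvgrPdist_lt _ _ _ (nbhs z) (nbhs_filter z)) => e e0.
exists e%:C; first by rewrite /= ltcR.
by move=> w /= zw; rewrite -ltcR -raddfB (le_lt_trans (normc_ge_Im _)).
Qed.

Lemma cvg_complex (T : Type) (F : set_system T) (h : T -> R[i]) (z : R[i]) :
  Filter F -> (fun x => complex.Re (h x)) @ F --> complex.Re z ->
  (fun x => complex.Im (h x)) @ F --> complex.Im z -> h @ F --> z.
Proof.
move=> FF hRe hIm.
have -> : h = fun x => (complex.Re (h x))%:C + 'i%C * (complex.Im (h x))%:C.
  by apply/funext => x; rewrite -complexE.
rewrite [X in _ --> X]complexE; apply: cvgD.
  exact: (cvg_comp _ _ hRe (@continuous_real_complex _)).
apply: cvgMl_tmp.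
exact: (cvg_comp _ _ hIm (@continuous_real_complex _)).
Qed.

End complex_limits.

(** * Bounded functionals on l^oo *)

(* The value is 0 when [u] is unbounded. *)
HB.lock Definition linfty_of (R : realType) (K : Type) (u : K -> R[i]) :
  linfty R K := insubd 0 u.

Section linfty_forms.
Variables (R : realType) (K : Type).
Local Open Scope complex_scope.
Local Notation L := (linfty R K).

Lemma linfty_ofE (u : K -> R[i]) (c : R) :
  (forall x, `|u x| <= c%:C) -> linfty_of u = u :> (K -> R[i]).
Proof.
move=> uc; rewrite unlock; apply: insubdK.
by apply/asboolP/bounded_complexP; exists c.
Qed.

Lemma linfty_eqP (u v : L) : (forall x, u x = v x) -> u = v.
Proof. by move=> uv; apply/val_inj/funext. Qed.

Lemma linfty_ofK (u : K -> R[i]) (hu : bounded_fun u) :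
  linfty_of u = to_linfty hu.
Proof.
have [c uc] := (bounded_complexP u).1 hu.
by apply: linfty_eqP => x; rewrite (linfty_ofE uc).
Qed.

Lemma linfty_bounded (u : L) : exists2 c : R, 0 <= c & forall x, `|u x| <= c%:C.
Proof.
have nE : linfty_norm u = (complex.Re (linfty_norm u))%:C by [].
exists (complex.Re (linfty_norm u)).
  by rewrite -lecR -nE linfty_norm_ge0.
by move=> x; rewrite -nE linfty_norm_ub.
Qed.

Lemma linftyD (u v : L) x : (u + v) x = u x + v x. Proof. by []. Qed.
Lemma linftyZ (a : R[i]) (u : L) x : (a *: u) x = a * u x. Proof. by []. Qed.

Lemma linfty_sumE (I : Type) (r : seq I) (P : pred I) (w : I -> L) x :
  (\sum_(i <- r | P i) w i) x = \sum_(i <- r | P i) w i x.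
Proof. exact: (big_morph (fun u : L => u x) (fun _ _ => erefl) erefl). Qed.

(* For empty [K] every [c] bounds [u], hence the condition [0 <= c]. *)
Definition real_form (C : R) (psi : L -> R) :=
  [/\ {morph psi : u v / u + v},
      forall (t : R) u, psi (t%:C *: u) = t * psi u &
      forall (u : L) (c : R), 0 <= c -> (forall x, `|u x| <= c%:C) ->
        `|psi u| <= C * c].

(** The general real-linear form carried by finitely many points: a complex value has two real
    coordinates, hence two families of weights. *)
Definition simple_form (T : finType) (al be : T -> R) (s : T -> K) (u : L) :=
  \sum_t (al t * complex.Re (u (s t)) + be t * complex.Im (u (s t))).

(** The classical formula for the complex-linear form with real part [psi]; it also rebuilds a mean
    from its real part. *)
Lemma complexify (psi : L -> R) : {morph psi : u v / u + v} ->
  (forall (t : R) u, psi (t%:C *: u) = t * psi u) ->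
  exists phi : {scalar L},
    forall u, phi u = (psi u)%:C - 'i * (psi ('i *: u))%:C.
Proof.
move=> psiD psiZ.
pose f u := (psi u)%:C - 'i * (psi ('i *: u))%:C.
have fl : scalar f.
  move=> a u v; rewrite /f.
  have psia w : psi (a *: w) =
      complex.Re a * psi w + complex.Im a * psi ('i *: w).
    rewrite {1}[a]complexE scalerDl psiD psiZ; congr +%R.
    by rewrite mulrC -scalerA psiZ.
  rewrite scalerDr scalerA [_ * a]mulrC -scalerA !psiD !psia.
  rewrite scalerA -expr2 sqr_i scaleN1r.
  have psiN w : psi (- w) = - psi w.
    by rewrite -scaleN1r -(rmorphN1 (real_complex R)) psiZ mulN1r.
  rewrite psiN; case: a {psia} => p q /=.
  by apply/eqP; rewrite eq_complex /=; apply/andP; split; apply/eqP; ring.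
pose phi : {scalar L} := HB.pack f (GRing.isLinear.Build R[i] L R[i] *%R f fl).
by exists phi.
Qed.

(** The factor [a] selects the part of interest: 1 gives Re, -i gives Im, and a conjugate number
    makes a prescribed value positive. *)
Lemma real_form_Re (phi : {scalar L}) (D : R) (a : R[i]) :
  (forall (u : L) (c : R), 0 <= c -> (forall x, `|u x| <= c%:C) ->
    `|phi u| <= (D * c)%:C) ->
  exists C, real_form C (fun u => complex.Re (a * phi u)).
Proof.
move=> phiD; exists (Normc.normc a * D); split.
- by move=> u v; rewrite linearD mulrDr raddfD.
- move=> t u; rewrite linearZ/= mulrCA; case: (a * phi u) => p q /=.
  by rewrite mul0r subr0.
- move=> u c c0 uc; rewrite -lecR (le_trans (normc_ge_Re _))// normrM.
  rewrite -mulrA rmorphM; apply: ler_wpM2l; first exact: normr_ge0.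
  exact: phiD.
Qed.

Lemma scalar_continuous_bounded (phi : {scalar L}) : continuous phi ->
  exists D : R,
    forall (u : L) (c : R), 0 <= c -> (forall x, `|u x| <= c%:C) ->
      `|phi u| <= (D * c)%:C.
Proof.
move=> /(_ 0); rewrite /continuous_at linear0.
move=> /(@cvgrPdist_le _ _ _ (nbhs (0 : L)) (nbhs_filter _)) /(_ 1 ltr01).
move=> /nbhs_norm0P[e /= e0 ephi].
have eR : (complex.Re e)%:C = e by rewrite RRe_real// gtr0_real.
have eR0 : 0 < complex.Re e by rewrite -ltcR eR.
(* Scaling [u] by e / (2c) puts it strictly inside the ball of radius e, whence the constant. The
   case c = 0 is split off because of this division. *)
exists (2 / complex.Re e) => u c; rewrite le_eqVlt => /predU1P[<- u0|c0 uc].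
  have -> : u = 0.
    by apply/val_inj/funext => x; apply/eqP; rewrite -normr_le0 u0.
  by rewrite linear0 normr0 mulr0.
have [t tE] : {t : R | t = complex.Re e / (2 * c)} by eexists.
have t0 : 0 < t by rewrite tE divr_gt0// mulr_gt0.
have : `|t%:C *: u| < e.
  rewrite normrZ norm_real_complex gtr0_norm// -eR.
  apply: (@le_lt_trans _ _ (t * c)%:C).
    rewrite rmorphM; apply: ler_wpM2l; first by rewrite lecR ltW.
    by apply: linfty_norm_le => //; rewrite lecR ltW.
  rewrite ltcR tE invfM mulrA mulfVK ?gt_eqF// ltr_pdivrMr// mulr_natr mulr2n.
  by rewrite ltrDl.
move=> /ephi /=; rewrite sub0r normrN linearZ/= normrM norm_real_complex.
rewrite (gtr0_norm t0) -ler_pdivlMl ?ltcR// mulr1 => /le_trans; apply.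
by rewrite -fmorphV lecR tE invf_div mulrAC.
Qed.

Lemma real_form_continuous (psi : L -> R) (C : R) (phi : {scalar L}) :
  real_form C psi ->
  (forall u, phi u = (psi u)%:C - 'i * (psi ('i *: u))%:C) -> continuous phi.
Proof.
case=> psiD psiZ psiC phiE.
have C0 : 0 <= `|C| by [].
have phiC (u : L) : `|phi u| <= ((`|C| + `|C|)%:C) * `|u|.
  have [c c0 uc] : exists2 c : R, 0 <= c & `|u| = c%:C.
    exists (complex.Re (linfty_norm u)) => //.
    by rewrite -lecR; exact: linfty_norm_ge0.
  have ux x : `|u x| <= c%:C by rewrite -uc; exact: linfty_norm_ub.
  have iux x : `|('i *: u) x| <= c%:C.
    by rewrite linftyZ normrM normci mul1r.
  rewrite uc -rmorphM mulrDl rmorphD phiE (le_trans (ler_normB _ _))// lerD//.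
    rewrite norm_real_complex lecR (le_trans (psiC _ _ c0 ux))//.
    by rewrite ler_wpM2r// ler_norm.
  rewrite normrM normci mul1r.
  rewrite norm_real_complex lecR (le_trans (psiC _ _ c0 iux))//.
  by rewrite ler_wpM2r// ler_norm.
move=> u; apply/(@cvgrPdist_lt _ _ _ (nbhs u) (nbhs_filter _)) => e e0.
have k0 : 0 < (`|C| + `|C| + 1)%:C by rewrite ltcR ltr_wpDl// addr_ge0.
near=> v; rewrite -linearB (le_lt_trans (phiC _))//.
apply: (@le_lt_trans _ _ ((`|C| + `|C| + 1)%:C * `|u - v|)).
  by rewrite ler_wpM2r// lecR lerDl.
rewrite -ltr_pdivlMl//.
by near: v; apply: cvgr_dist_lt => //; rewrite mulr_gt0// invr_gt0.
Unshelve. all: by end_near. Qed.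

(** A bounded real form is the real part of a continuous complex form, and the weak topology makes
    the latter continuous. *)
Lemma real_form_cvg (psi : L -> R) (C : R) (F : set_system L) (u : L) :
  real_form C psi -> Filter F -> F --> (u : weak L) -> psi @ F --> psi u.
Proof.
move=> psiC FF /cvg_weak Fu.
have [psiD psiZ _] := psiC; have [phi phiE] := complexify psiD psiZ.
have psiE : psi = fun v => complex.Re (phi v).
  by apply/funext => v; rewrite phiE /=; ring.
rewrite psiE; apply: (cvg_comp _ _ (Fu phi (real_form_continuous psiC phiE))).
exact: continuous_Re.
Qed.

End linfty_forms.

(** * Approximation of bounded forms by combinations of point evaluations *)

Section approximation.
Variables (R : realType) (K : Type).
Local Open Scope complex_scope.
Local Notation L := (linfty R K).

(** The cells are the preimages of consecutive intervals of length [e] covering [-c, c]; [q] returns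
    the index of the interval. *)
Lemma real_cells (v : K -> R) (c e : R) : (forall x, `|v x| <= c) -> 0 < e ->
  exists (T : finType) (q : K -> T), forall x y, q x = q y -> `|v x - v y| <= e.
Proof.
move=> vc e0; pose n x := Num.truncn ((v x + c) / e).
have vc0 x : 0 <= (v x + c) / e.
  rewrite divr_ge0 ?(ltW e0)// -lerBlDr sub0r lerNl (le_trans _ (vc x))//.
  by rewrite -normrN ler_norm.
have nN x : (n x < (Num.truncn ((c + c) / e)).+1)%N.
  rewrite ltnS; apply: le_truncn; rewrite ler_pM2r ?invr_gt0// lerD2r.
  exact: le_trans (ler_norm _) (vc x).
exists 'I_(Num.truncn ((c + c) / e)).+1, (fun x => Ordinal (nN x)) => x y [nxy].
have /andP[x1 x2] := truncn_itv (vc0 x).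
have /andP[y1 y2] := truncn_itv (vc0 y).
rewrite -/(n x) in x1 x2; rewrite -/(n y) -nxy in y1 y2.
have -> : v x - v y = e * ((v x + c) / e - (v y + c) / e).
  by rewrite -mulrBl mulrCA divff ?gt_eqF// mulr1; ring.
rewrite normrM gtr0_norm// -[leRHS]mulr1 ler_pM2l//.
rewrite -natr1 in x2 y2.
by rewrite ler_norml; apply/andP; split; lra.
Qed.

(** Common refinement, through products of index types, of the partitions of mesh e / 2 for the real
    and imaginary parts of each function. *)
Lemma linfty_cells (us : seq L) (e : R) : 0 < e ->
  exists (T : finType) (q : K -> T), forall u, u \in us ->
    forall x y, q x = q y -> `|u x - u y| <= e%:C.
Proof.
move=> e0; elim: us => [|u us [T [q qP]]]; first by exists unit, (fun=> tt).
have [c _ uc] := linfty_bounded u.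
have e20 : 0 < e / 2 by rewrite divr_gt0.
have Rec x : `|complex.Re (u x)| <= c.
  by rewrite -lecR (le_trans (normc_ge_Re _)).
have Imc x : `|complex.Im (u x)| <= c.
  by rewrite -lecR (le_trans (normc_ge_Im _)).
have [T1 [q1 q1P]] := real_cells Rec e20.
have [T2 [q2 q2P]] := real_cells Imc e20.
exists (T1 * T2 * T)%type, (fun x => (q1 x, q2 x, q x)) => v.
rewrite inE => /predU1P[->|vus] x y [q1e q2e qe]; last exact: qP.
rewrite [u x - u y]complexE (le_trans (ler_normD _ _))// normrM normci mul1r.
rewrite !norm_real_complex -rmorphD lecR [leRHS]splitr !raddfB lerD//.
  exact: q1P.
exact: q2P.
Qed.

(* The functions [u] of [us] are nearly constant on the cells of a finite
   partition, and [s] selects a point in each cell. *)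
Lemma real_form_approx (psi : L -> R) (C : R) (x0 : K) (us : seq L) (e : R) :
  real_form C psi -> 0 < e ->
  exists (T : finType) (al be : T -> R) (s : T -> K),
    [/\ \sum_t `|al t| <= C, \sum_t `|be t| <= C &
        forall u, u \in us ->
          `|psi u - simple_form al be s u| <= e].
Proof.
move=> [psiD psiZ psiC] e0.
have psi0 : psi 0 = 0.
  by rewrite -(scale0r 0) -(rmorph0 (real_complex R)) psiZ mul0r.
have C0 : 0 <= C.
  have zero_le1 x : `|(0 : L) x| <= 1%:C by rewrite normr0 lecR ler01.
  by have := psiC 0 1 ler01 zero_le1; rewrite psi0 normr0 mulr1.
have C1 : 0 < C + 1 by rewrite ltr_wpDl.
(* An error e / (C + 1) in sup norm costs at most C e / (C + 1) <= e under [psi]; the 1 covers C =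
   0. *)
have [T [q qP]] := linfty_cells us (divr_gt0 e0 C1).
pose step (h : T -> R[i]) : L := linfty_of (h \o q).
have stepE h x : step h x = h (q x).
  rewrite /step (@linfty_ofE _ _ _ (\sum_t Normc.normc (h t)))// => {}x /=.
  rewrite rmorph_sum (bigD1 (q x))//= lerDl sumr_ge0// => t _.
  exact: (normr_ge0 (h t)).
pose al t := psi (step (fun t' => (t' == t)%:R)).
pose be t := psi ('i *: step (fun t' => (t' == t)%:R)).
have psi_sum (I : Type) (r : seq I) (w : I -> L) :
    psi (\sum_(i <- r) w i) = \sum_(i <- r) psi (w i).
  exact: (big_morph psi psiD psi0).
have psi_step h : psi (step h) =
    \sum_t (al t * complex.Re (h t) + be t * complex.Im (h t)).
  have -> : step h = \sum_t (
       (complex.Re (h t))%:C *: step (fun t' => (t' == t)%:R)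
     + (complex.Im (h t))%:C *: ('i *: step (fun t' => (t' == t)%:R))).
    apply: linfty_eqP => x; rewrite linfty_sumE (bigD1 (q x))// big1 => [|t tq].
      rewrite linftyD !linftyZ !stepE eqxx [RHS]addr0 !mulr1.
      by rewrite {1}[h (q x)]complexE [_ * 'i]mulrC.
    by rewrite linftyD !linftyZ !stepE eq_sym (negPf tq) !mulr0 addr0.
  rewrite psi_sum; apply: eq_bigr => t _.
  by rewrite psiD !psiZ mulrC [_ * be t]mulrC.
have sg1 (r : R) : `|(Num.sg r)%:C| <= 1%:C.
  by rewrite norm_real_complex lecR normr_sg lern1; case: (r != 0).
(* [x0] is a dummy for the empty cells. *)
have /choice[s sP] : forall t, exists x, (exists y, q y = t) -> q x = t.
  move=> t; have [[y <-]|] := pselect (exists y, q y = t); first by exists y.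
  by exists x0.
exists T, al, be, s; split.
(* The sum of the [|al t|] is the value of [psi] on the step function of their signs, which is
   bounded by 1. For [be] the signs are multiplied by i. *)
- have psile := psiC (step (fun t => (Num.sg (al t))%:C)) 1 ler01.
  rewrite -[leRHS]mulr1.
  apply: (le_trans _ (le_trans (ler_norm _) (psile _))) => [|x]; last first.
    by rewrite stepE.
  rewrite psi_step ler_sum// => t _ /=.
  by rewrite mulr0 addr0 mulrC -normrEsg.
- have psile := psiC (step (fun t => 'i * (Num.sg (be t))%:C)) 1 ler01.
  rewrite -[leRHS]mulr1.
  apply: (le_trans _ (le_trans (ler_norm _) (psile _))) => [|x]; last first.
    by rewrite stepE normrM normci mul1r.
  rewrite psi_step ler_sum// => t _ /=.
  by rewrite !(mul0r, mulr0, mul1r, oppr0, add0r) [_ * Num.sg _]mulrC -normrEsg.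
- move=> u uus.
  have -> : simple_form al be s u = psi (step (u \o s)) by rewrite psi_step.
  have psiN w : psi (- w) = - psi w.
    by rewrite -scaleN1r -(rmorphN1 (real_complex R)) psiZ mulN1r.
  rewrite -psiN -psiD.
  have e'0 : 0 <= e / (C + 1) by rewrite divr_ge0// ltW.
  apply: le_trans (psiC _ _ e'0 _) _ => [x|].
    rewrite -[X in `|X|]/(u x - step (u \o s) x) stepE/=.
    by apply: qP => //; rewrite sP//; exists x.
  by rewrite mulrCA ler_piMr ?(ltW e0)// ler_pdivrMr// mul1r lerDl.
Qed.

End approximation.

(** * Means of real functions *)

Section bounded_real.
Variables (R : realType) (I : Type).
Local Open Scope complex_scope.
Local Notation L := (linfty R I).

Definition bounded_real (h : I -> R) : Prop := exists c, forall x, `|h x| <= c.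

Lemma bounded_realD (h k : I -> R) :
  bounded_real h -> bounded_real k -> bounded_real (fun x => h x + k x).
Proof.
move=> [c hc] [d kd]; exists (c + d) => x.
by rewrite (le_trans (ler_normD _ _))// lerD.
Qed.

Lemma bounded_realZ (a : R) (h : I -> R) :
  bounded_real h -> bounded_real (fun x => a * h x).
Proof.
by move=> [c hc]; exists (`|a| * c) => x; rewrite normrM ler_wpM2l ?hc.
Qed.

Lemma bounded_real_cst (a : R) : bounded_real (fun=> a).
Proof. by exists `|a|. Qed.

Lemma bounded_real_sum (T : Type) (r : seq T) (h : T -> I -> R) :
  (forall t, bounded_real (h t)) -> bounded_real (fun x => \sum_(t <- r) h t x).
Proof.
move=> bh; elim: r => [|t r IH].
  by exists 0 => x; rewrite big_nil normr0.
have [c hc] := bounded_realD (bh t) IH.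
by exists c => x; rewrite big_cons.
Qed.

Lemma bounded_Re (u : L) :
  bounded_real (fun x => complex.Re (u x)).
Proof.
have [c _ uc] := linfty_bounded u.
by exists c => x; rewrite -lecR (le_trans (normc_ge_Re _)).
Qed.

Lemma bounded_Im (u : L) :
  bounded_real (fun x => complex.Im (u x)).
Proof.
have [c _ uc] := linfty_bounded u.
by exists c => x; rewrite -lecR (le_trans (normc_ge_Im _)).
Qed.

Lemma bounded_real_indic (D : set I) : bounded_real (\1_D : I -> R).
Proof.
by exists 1 => x; rewrite indicE; case: (_ \in _); rewrite ?normr1 ?normr0.
Qed.

End bounded_real.

Section real_mean.
Variables (R : realType) (I : Type) (M : mean R I).
Local Open Scope complex_scope.
Local Notation L := (linfty R I).

(** Real values allow order arguments. On an unbounded [h] the value is M 0 = 0, hence the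
    boundedness hypotheses below. *)
Definition rmean (h : I -> R) : R :=
  complex.Re (M (linfty_of (fun x => (h x)%:C))).

Lemma linfty_of_realE (h : I -> R) x :
  bounded_real h -> linfty_of (fun x => (h x)%:C) x = (h x)%:C.
Proof.
move=> [c hc]; rewrite (@linfty_ofE _ _ _ c)// => y.
by rewrite norm_real_complex lecR.
Qed.

Lemma rmeanD (h k : I -> R) : bounded_real h -> bounded_real k ->
  rmean (fun x => h x + k x) = rmean h + rmean k.
Proof.
move=> bh bk; rewrite /rmean -raddfD -linearD; congr (complex.Re (M _)).
apply: linfty_eqP => x; rewrite linftyD !linfty_of_realE//; last first.
  exact: bounded_realD.
exact: (rmorphD (real_complex R)).
Qed.

Lemma rmeanZ (a : R) (h : I -> R) : bounded_real h ->
  rmean (fun x => a * h x) = a * rmean h.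
Proof.
move=> bh; rewrite /rmean.
have -> : linfty_of (fun x => (a * h x)%:C) =
    a%:C *: linfty_of (fun x => (h x)%:C).
  apply: linfty_eqP => x; rewrite linftyZ !linfty_of_realE//; last first.
    exact: bounded_realZ.
  exact: (rmorphM (real_complex R)).
by rewrite linearZ/=; case: (M _) => p q /=; rewrite mul0r subr0.
Qed.

Lemma rmean_cst (a : R) : rmean (fun=> a) = a.
Proof.
have -> : (fun=> a) = (fun _ : I => a * 1) by rewrite mulr1.
rewrite (rmeanZ a (bounded_real_cst I 1)) -[RHS]mulr1; congr (_ * _).
rewrite /rmean; have := mean1 M; set e := to_linfty _ => M1.
have -> : linfty_of (fun=> 1%:C) = e; last by rewrite M1.
by apply: linfty_eqP => x; rewrite (linfty_of_realE x (bounded_real_cst I 1)).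
Qed.

Lemma rmean_sum (T : Type) (r : seq T) (h : T -> I -> R) :
  (forall t, bounded_real (h t)) ->
  rmean (fun x => \sum_(t <- r) h t x) = \sum_(t <- r) rmean (h t).
Proof.
move=> bh; elim: r => [|t r IH].
  rewrite big_nil -[RHS](rmean_cst); congr rmean; apply/funext => x.
  by rewrite big_nil.
rewrite big_cons -IH -rmeanD//; last exact: bounded_real_sum.
by congr rmean; apply/funext => x; rewrite big_cons.
Qed.

Lemma rmean_le (h k : I -> R) : bounded_real h -> bounded_real k ->
  (forall x, h x <= k x) -> rmean h <= rmean k.
Proof.
move=> bh bk hk; rewrite -subr_ge0 -mulN1r -(rmeanZ _ bh).
rewrite -(rmeanD bk (bounded_realZ _ bh)).
have bkh := bounded_realD bk (bounded_realZ (-1) bh).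
have : 0 <= M (linfty_of (fun x => (k x + -1 * h x)%:C)).
  apply: mean_ge0 => x; rewrite (linfty_of_realE x bkh) lecR mulN1r subr_ge0.
  exact: hk.
by rewrite /rmean; case: (M _) => p q /=; rewrite lecE /= => /andP[].
Qed.

(** If [u] is real and |u| <= c, then c + u >= 0, so c + M u is a nonnegative real. *)
Lemma mean_real (u : L) : (forall x, u x \is Num.real) -> M u \is Num.real.
Proof.
move=> ur; have [c c0 uc] := linfty_bounded u.
have M1 := mean1 M; set e := to_linfty _ in M1.
have Mc : M (c%:C *: e) = c%:C by rewrite linearZ/= M1 mulr1.
have : 0 <= M (c%:C *: e + u).
  apply: mean_ge0 => x; rewrite linftyD linftyZ mulr1.
  have := uc x; rewrite real_ler_norml// => /andP[+ _].
  by rewrite -subr_ge0 opprK addrC.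
rewrite linearD Mc => /ger0_real H.
by rewrite -[M u](addKr c%:C) realD// realN; apply/complex_realP; exists c.
Qed.

Lemma Re_mean (u : L) : complex.Re (M u) = rmean (fun x => complex.Re (u x)).
Proof.
have bRe := bounded_Re u; have bIm := bounded_Im u.
have {1}-> : u = linfty_of (fun x => (complex.Re (u x))%:C)
    + 'i *: linfty_of (fun x => (complex.Im (u x))%:C).
  apply: linfty_eqP => x; rewrite linftyD linftyZ !linfty_of_realE//.
  exact: complexE.
rewrite linearD linearZ/= raddfD.
have : M (linfty_of (fun x => (complex.Im (u x))%:C)) \is Num.real.
  apply: mean_real => x; rewrite linfty_of_realE//; apply/complex_realP.
  by exists (complex.Im (u x)).
move: (M (linfty_of _)) => z /complex_realP[k ->].
by rewrite /= mul0r mul1r subr0 addr0.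
Qed.

Lemma Im_mean (u : L) :
  complex.Im (M u) = rmean (fun x => complex.Im (u x)).
Proof.
rewrite ImE_Re; transitivity (complex.Re (M (- 'i *: u))).
  by rewrite linearZ.
by rewrite Re_mean; congr rmean; apply/funext => x; rewrite ImE_Re.
Qed.

End real_mean.

(** * The finitely additive content attached to a mean *)

Section content.
Variables (R : realType) (I : Type) (M : mean R I).

Definition content (D : set I) : R := rmean M \1_D.

Lemma le_content (A B : set I) : A `<=` B -> content A <= content B.
Proof.
move=> AB; apply: rmean_le; try exact: bounded_real_indic.
move=> x; rewrite !indicE ler_nat; case: (boolP (x \in A)) => //.
by move=> /set_mem/AB/mem_set ->.
Qed.

Lemma content_ge0 (A : set I) : 0 <= content A.
Proof.
rewrite -[leLHS](rmean_cst M 0); apply: rmean_le.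
- exact: bounded_real_cst.
- exact: bounded_real_indic.
- by move=> x; rewrite indicE ler0n.
Qed.

Lemma content_le1 (A : set I) : content A <= 1.
Proof.
rewrite -[leRHS](rmean_cst M 1); apply: rmean_le.
- exact: bounded_real_indic.
- exact: bounded_real_cst.
- by move=> x; rewrite indicE lern1; case: (_ \in _).
Qed.

Lemma contentUI (A B : set I) :
  content (A `|` B) + content (A `&` B) = content A + content B.
Proof.
rewrite /content -!rmeanD; try exact: bounded_real_indic.
congr rmean; apply/funext => x; rewrite !indicE in_setU in_setI.
by case: (_ \in A) => /=; case: (_ \in B); rewrite ?addr0// ?add0r.
Qed.

Lemma contentU (A B : set I) : content (A `|` B) <= content A + content B.
Proof. by rewrite -contentUI lerDl content_ge0. Qed.

Lemma content0 : content set0 = 0.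
Proof. by rewrite /content indic0 -[RHS](rmean_cst M). Qed.

(* Sets that are not [big] form an ideal: when adjoining a test function [nu] to
   a big [D] never gives a big [D `&` A nu], disjointifying these small sets
   produces sets of arbitrarily large content. *)
Lemma interlacing_sequences (X : Type) (h : X -> I -> R) (c e : R) : 0 < e ->
  (forall nu i, `|h nu i| <= c) ->
  (forall S : set I, finite_set S ->
    exists nu, (forall i, S i -> h nu i <= e) /\ 3 * e <= rmean M (h nu)) ->
  exists (nu : nat -> X) (i : nat -> I),
    (forall k m, (k <= m)%N -> 2 * e <= h (nu k) (i m)) /\
    (forall k m, (m < k)%N -> h (nu k) (i m) <= e).
Proof.
move=> e0 hc hS.
pose good (S : set I) nu := forall i, S i -> h nu i <= e.
pose A nu := [set i | 2 * e <= h nu i].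
(* The bound [eta] does not depend on [S]: enlarging [S] to meet a further constraint keeps the same
   lower bound. *)
pose big D := exists2 eta, 0 < eta & forall S, finite_set S ->
  exists2 nu, good S nu & eta <= content (D `&` A nu).
have smallP D : ~ big D -> forall eta, 0 < eta -> exists2 S, finite_set S &
    forall nu, good S nu -> content (D `&` A nu) < eta.
  move=> nD eta eta0; apply: contrapT => nS; apply: nD; exists eta => // S fS.
  apply: contrapT => nnu; apply: nS; exists S => // nu gnu.
  by rewrite ltNge; apply/negP => le; apply: nnu; exists nu.
have goodU S S' nu : good (S `|` S') nu -> good S nu /\ good S' nu.
  by move=> g; split=> i Si; apply: g; [left|right].
have smallU D D' : ~ big D -> ~ big D' -> ~ big (D `|` D').
  move=> /smallP nD /smallP nD' [eta eta0 bDD'].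
  have [S fS SP] := nD _ (divr_gt0 eta0 (@ltr0Sn R 1)).
  have [S' fS' SP'] := nD' _ (divr_gt0 eta0 (@ltr0Sn R 1)).
  have [|nu /goodU[gS gS']] := bDD' (S `|` S'); first by rewrite finite_setU.
  rewrite setIUl => le; have := contentU (D `&` A nu) (D' `&` A nu).
  by have := SP _ gS; have := SP' _ gS'; lra.
have bigT : big setT.
  (* A negative [c] would force [I] to be empty, and then the mean of [h nu] would be 0 instead of
     at least 3e. *)
  have c0 : 0 <= c.
    have [nu [_ nu_ge]] := hS set0 (finite_set0 _).
    apply: contrapT => /negP; rewrite -ltNge => c0.
    have I0 (x : I) : False.
      by have := le_trans (normr_ge0 _) (hc nu x); rewrite leNgt c0.
    have nuE : h nu = fun=> 0 by apply/funext => x; case: (I0 x).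
    by move: nu_ge; rewrite nuE rmean_cst leNgt mulr_gt0.
  exists (e / (c + 1)); first by rewrite divr_gt0// ltr_wpDl.
  move=> S /hS[nu [gnu nu_ge]]; exists nu => //.
  rewrite setTI ler_pdivrMr ?ltr_wpDl//.
  (* Chebyshev's argument: [h nu] is below 2e off [A nu] and at most c on it, so 3e <= 2e + c
     content(A nu). *)
  have : rmean M (h nu) <= rmean M (fun x => 2 * e + c * \1_(A nu) x).
    apply: rmean_le; first by exists c.
      apply: bounded_realD; first exact: bounded_real_cst.
      exact/bounded_realZ/bounded_real_indic.
    move=> x; rewrite indicE; case: (boolP (x \in A nu)) => [|/negP xA].
      rewrite mulr1 => _; rewrite (le_trans (ler_norm _))//.
      by rewrite (le_trans (hc _ _))// lerDr mulr_ge0// ltW.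
    rewrite mulr0 addr0 ltW// ltNge; apply/negP => le; apply: xA.
    exact: mem_set.
  rewrite rmeanD; first last.
  - exact/bounded_realZ/bounded_real_indic.
  - exact: bounded_real_cst.
  rewrite rmean_cst rmeanZ; last exact: bounded_real_indic.
  rewrite -/(content (A nu)); have := content_ge0 (A nu).
  by set t := content _; nra.
have big_step D S : big D -> finite_set S ->
    exists2 nu, good S nu & big (D `&` A nu).
  move=> [eta eta0 bD] fS; apply: contrapT => nnu.
  have : forall k, exists2 U, ~ big U & k%:R * (eta / 2) <= content U.
    elim=> [|k [U nU Uk]].
      exists set0; last by rewrite mul0r content_ge0.
      move=> [eta' eta'0 /(_ _ (finite_set0 _))[nu _]].
      by rewrite set0I content0 leNgt eta'0.
    (* Requiring [nu] to be small on [S'] too makes [A nu] meet [U] in content below eta / 2, so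
       adjoining the new set, of content at least eta, adds more than eta / 2. *)
    have [S' fS' SP'] := smallP _ nU _ (divr_gt0 eta0 (@ltr0Sn R 1)).
    have [|nu /goodU[gS gS'] le] := bD (S `|` S'); first by rewrite finite_setU.
    exists (U `|` (D `&` A nu)).
      by apply: smallU => // bDA; apply: nnu; exists nu.
    have := contentUI U (D `&` A nu).
    have : content (U `&` (D `&` A nu)) <= content (U `&` A nu).
      by apply: le_content => x [Ux [_ Ax]].
    have := SP' _ gS'; rewrite -[k.+1%:R]natr1 mulrDl mul1r; lra.
  move=> /(_ (Num.truncn (2 / eta)).+1)[U _].
  apply/negP; rewrite -ltNge (le_lt_trans (content_le1 _))//.
  rewrite -ltr_pdivrMr ?divr_gt0// invf_div mul1r.
  exact: truncnS_gt.
have big_ne D : big D -> D !=set0.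
  move=> [eta eta0 /(_ _ (finite_set0 _))[nu _]] le.
  apply/set0P/negP => /eqP D0; move: le.
  by rewrite D0 set0I content0 leNgt eta0.
have [i0 _] := big_ne _ bigT.
have [nu0 _] := hS set0 (finite_set0 _).
have /choice[next nextP] : forall p : set I * set I, exists q : X * I,
    big p.1 -> finite_set p.2 ->
    [/\ good p.2 q.1, big (p.1 `&` A q.1) & (p.1 `&` A q.1) q.2].
  move=> [D S] /=.
  have [[bD fS]|n] := pselect (big D /\ finite_set S); last first.
    (* Dummy value outside the admissible states, which by [st_inv] are never left. *)
    by exists (nu0, i0) => bD fS; case: n.
  have [nu gnu bnu] := big_step _ _ bD fS; have [i Di] := big_ne _ bnu.
  by exists (nu, i).
(* The state consists of the set where all chosen test functions are large and the finite set of
   chosen points. *)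
pose st n := iter n (fun p : set I * set I =>
  (p.1 `&` A (next p).1, p.2 `|` [set (next p).2])) (setT, set0).
have st_inv n : big (st n).1 /\ finite_set (st n).2.
  elim: n => [|n [bD fS]] /=; first by split.
  have [_ bD' _] := nextP _ bD fS; split => //.
  by rewrite finite_setU; split.
have st_dec k m : (k <= m)%N ->
    (st m).1 `<=` (st k).1 /\ (st k).2 `<=` (st m).2.
  move=> /subnK <-; elim: (m - k)%N => [|n [IH1 IH2]]; first by split.
  rewrite addSn /=; split=> x; first by move=> [/IH1].
  by move=> /IH2; left.
exists (fun k => (next (st k)).1), (fun m => (next (st m)).2); split=> k m km.
  have [bD fS] := st_inv m; have [_ _ im] := nextP _ bD fS.
  (* Point m lies in the set of stage m + 1, hence in the larger one of stage k + 1, on which test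
     function k is large. *)
  have [_ ] : (st k.+1).1 (next (st m)).2.
    by have [+ _] := @st_dec k.+1 m.+1 km; apply.
  by [].
(* Point m is recorded by stage m + 1 <= k, and test function k is small on all points recorded at
   stage k. *)
have [bD fS] := st_inv k; have [gS _ _] := nextP _ bD fS; apply: gS.
have [_ +] := @st_dec m.+1 k km; apply.
by right.
Qed.

End content.

(** * Exchange of means for weakly compact rows *)

(** Along an ultrafilter a cluster point is a limit: the preimage of a neighbourhood or its
    complement belongs to [W]. *)
Lemma ultra_compact_cvg (T : Type) (X : topologicalType) (W : set_system T)
    (A : set X) (g : T -> X) : UltraFilter W -> compact A ->
  (\forall t \near W, A (g t)) -> exists2 x, A x & g @ W --> x.
Proof.
move=> WU cA WA; have WP := @ultra_proper _ _ WU.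
have [x [Ax xW]] := cA (g @ W) _ WA.
exists x => // U xU; have [//|WnU] := in_ultra_setVsetC (g @^-1` U) WU.
by have [y [nUy Uy]] := xW (~` U) U WnU xU.
Qed.

Lemma ultra_bounded_cvg (R : realType) (T : Type) (W : set_system T)
    (g : T -> R) (c : R) : UltraFilter W -> (forall t, `|g t| <= c) ->
  exists l : R, g @ W --> l.
Proof.
move=> WU gc; have WP := @ultra_proper _ _ WU.
have [|l _ gl] :=
  @ultra_compact_cvg _ _ W _ g WU (@segment_compact R (- c) c); last by exists l.
by apply: nearW => t /=; rewrite in_itv/= -ler_norml.
Qed.

Section fubini.
Variables (R : realType).
Local Open Scope complex_scope.

(** On an empty type the constant 1 equals 0, yet its mean is 1. *)
Lemma mean_inhabited (K : Type) (M : mean R K) : exists x : K, True.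
Proof.
apply: contrapT => K0; have := mean1 M; set e := to_linfty _.
have -> : e = 0 by apply: linfty_eqP => x; case: K0; exists x.
by rewrite linear0 => /eqP; rewrite eq_sym oner_eq0.
Qed.

Lemma real_form_simple (K : Type) (T : finType) (al be : T -> R) (s : T -> K)
    (C : R) :
  \sum_t `|al t| <= C -> \sum_t `|be t| <= C ->
  real_form (C + C) (simple_form al be s).
Proof.
move=> alC beC; split.
- move=> u v; rewrite /simple_form -big_split; apply: eq_bigr => t _.
  by rewrite !linftyD !raddfD /=; ring.
- move=> a u; rewrite /simple_form mulr_sumr; apply: eq_bigr => t _.
  by rewrite !linftyZ; case: (u (s t)) => p q /=; ring.
- move=> u c c0 uc.
  rewrite /simple_form (le_trans (ler_norm_sum _ _ _))//.
  apply: (@le_trans _ _ (\sum_t (`|al t| * c + `|be t| * c))).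
    apply: ler_sum => t _; rewrite (le_trans (ler_normD _ _))// !normrM lerD//.
      by rewrite ler_wpM2l// -lecR (le_trans (normc_ge_Re _)).
    by rewrite ler_wpM2l// -lecR (le_trans (normc_ge_Im _)).
  by rewrite big_split/= -!mulr_suml -mulrDl ler_wpM2r// lerD.
Qed.

Lemma real_formB (K : Type) (psi psi' : linfty R K -> R) (C C' : R) :
  real_form C psi -> real_form C' psi' ->
  real_form (C + C') (fun u => psi u - psi' u).
Proof.
move=> [pD pZ pC] [pD' pZ' pC']; split.
- by move=> u v; rewrite pD pD'; ring.
- by move=> a u; rewrite pZ pZ'; ring.
- move=> u c c0 uc; rewrite (le_trans (ler_normB _ _))// mulrDl lerD//.
    exact: pC.
  exact: pC'.
Qed.

(** A form of Banach-Alaoglu: pointwise limits exist by boundedness, and linearity and the bound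
    pass to them. *)
Lemma real_form_ultralimit (K : Type) (T : Type) (W : set_system T)
    (theta : T -> linfty R K -> R) (C : R) :
  UltraFilter W -> (forall t, real_form C (theta t)) ->
  exists2 psi, real_form C psi & forall u, theta^~ u @ W --> psi u.
Proof.
move=> WU thC; have WP := @ultra_proper _ _ WU.
have /choice[psi psiP] : forall u, exists l : R, theta^~ u @ W --> l.
  move=> u; have [c c0 uc] := linfty_bounded u.
  apply: (@ultra_bounded_cvg _ _ _ _ (C * c)) => // t.
  by have [_ _] := thC t; apply.
exists psi => //; split.
- move=> u v.
  apply: (@cvg_unique _ (@Rhausdorff R) _ _ _ _ (psiP (u + v))) => /=.
  have -> : theta^~ (u + v) = theta^~ u \+ theta^~ v.
    by apply/funext => t /=; have [-> _ _] := thC t.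
  exact: cvgD.
- move=> a u.
  apply: (@cvg_unique _ (@Rhausdorff R) _ _ _ _ (psiP (a%:C *: u))) => /=.
  have -> : theta^~ (a%:C *: u) = fun t => a * theta t u.
    by apply/funext => t /=; have [_ -> _] := thC t.
  exact: cvgMl_tmp.
- move=> u c c0 uc.
  have le_near : \forall t \near W, [set y | y <= C * c] `|theta t u|.
    by apply: nearW => t; have [_ _] := thC t; apply.
  exact: (closed_cvg _ (@closed_le R (C * c)) le_near _ (cvg_norm (psiP u))).
Qed.

(** Finite combinations of evaluations commute with [M] by additivity; this makes them usable as
    approximants of [N]. *)
Lemma rmean_simple_form (I J : Type) (f : I * J -> R[i]) (hf : bounded_fun f)
    (M : mean R I) (T : finType) (al be : T -> R) (s : T -> J) :
  rmean M (fun i => simple_form al be s (linfty_row hf i)) =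
  simple_form al be s (mean_col hf M).
Proof.
have bR t := bounded_Re (linfty_col hf (s t)).
have bI t := bounded_Im (linfty_col hf (s t)).
transitivity (\sum_t rmean M (fun i =>
    al t * complex.Re (linfty_col hf (s t) i)
    + be t * complex.Im (linfty_col hf (s t) i))).
  rewrite -rmean_sum// => t.
  by apply: bounded_realD; apply: bounded_realZ.
apply: eq_bigr => t _; rewrite rmeanD; try exact: bounded_realZ.
by rewrite !rmeanZ// -Re_mean -Im_mean.
Qed.

Lemma fubini_of_rows (I J : Type) (f : I * J -> R[i]) (hf : bounded_fun f) :
  relatively_weakly_compact (range (linfty_row hf)) ->
  forall (M : mean R I) (N : mean R J), N (mean_col hf M) = M (mean_row hf N).
Proof.
move=> cpt M N; apply: contrapT => /eqP; rewrite -subr_eq0.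
set z := N _ - M _ => z0.
(* Pairing with the conjugate of [z] turns the defect of commutation into the positive number
   |z|^2. *)
pose cc := z^*; pose psi0 u := complex.Re (cc * N u).
have [C psi0C] : exists C, real_form C psi0.
  apply: (@real_form_Re _ _ _ 2) => u c c0 uc.
  by rewrite mulr_natl mulr2n; exact: mean_bounded.
(* A quarter of the defect: approximating up to e leaves 4e - e = 3e, the mean that
   [interlacing_sequences] asks for. *)
pose e := complex.Re (cc * z) / 4.
have e0 : 0 < e.
  rewrite divr_gt0// -ltcR; have := z0; rewrite -normr_gt0 => zn.
  have : 0 < `|z| ^+ 2 by rewrite exprn_gt0.
  rewrite sqr_normc mulrC -/cc => z2; rewrite RRe_real//.
  exact: gtr0_real.
have [j0 _] := mean_inhabited N.
have [c [c0 fc]] : exists c : R, 0 <= c /\ forall p, `|f p| <= c%:C.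
  have [c fc] := (bounded_complexP f).1 hf.
  by exists `|c|; split=> // p; rewrite (le_trans (fc p))// lecR ler_norm.
have rowc i j : `|linfty_row hf i j| <= c%:C by exact: fc.
(* The test functionals are uniformly bounded and commute with [M] on [f]. *)
pose X := {nu : linfty R J -> R | real_form (C + C) nu /\
  rmean M (fun i => nu (linfty_row hf i)) = nu (mean_col hf M)}.
pose theta (nu : X) u := sval nu u - psi0 u.
have thetaC (nu : X) : real_form (C + C + C) (theta nu).
  by have [H _] := svalP nu; exact: real_formB.
have row_bounded psi D : real_form D psi ->
    bounded_real (fun i => psi (linfty_row hf i)).
  by move=> [_ _ psiD]; exists (D * c) => i; apply: psiD => //; exact: rowc.
have [|S fS|nu [i [nui_ge nui_le]]] := @interlacing_sequences R I M X
    (fun nu i => theta nu (linfty_row hf i)) ((C + C + C) * c) e e0.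
- by move=> nu i; have [_ _] := thetaC nu; apply => //; exact: rowc.
- have /finite_seqP[us usE] := finite_image (linfty_row hf) fS.
  (* Besides the rows indexed by [S], the approximation covers [mean_col hf M], which controls the
     mean of [theta]. *)
  have [T [al [be [s [alC beC approx]]]]] :=
    real_form_approx j0 (mean_col hf M :: us) psi0C e0.
  pose nu0 := simple_form al be s.
  have nuX : real_form (C + C) nu0 /\
      rmean M (fun i => nu0 (linfty_row hf i)) = nu0 (mean_col hf M).
    by split; [exact: real_form_simple|exact: rmean_simple_form].
  exists (exist _ nu0 nuX); split=> [i Si|].
    have usi : linfty_row hf i \in us.
      by have : [set` us] (linfty_row hf i) by rewrite -usE; exists i.
    have := approx (linfty_row hf i); rewrite in_cons usi orbT => /(_ isT).
    by rewrite distrC; apply: le_trans; exact: ler_norm.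
  have -> : (fun i => theta (exist _ nu0 nuX) (linfty_row hf i)) =
      fun i => nu0 (linfty_row hf i) + -1 * psi0 (linfty_row hf i).
    by apply/funext => i; rewrite mulN1r.
  have [_ nu0E] := nuX.
  rewrite rmeanD; first last.
  - exact/bounded_realZ/(row_bounded _ _ psi0C).
  - by have [H _] := nuX; exact: row_bounded H.
  rewrite rmeanZ; last exact: row_bounded psi0C.
  rewrite nu0E -(Re_mean M (cc *: mean_row hf N)) linearZ/= mulN1r.
  have := approx (mean_col hf M) (mem_head _ _).
  rewrite -/nu0 => /(le_trans (ler_norm _)).
  have : 4 * e = psi0 (mean_col hf M) - complex.Re (cc * M (mean_row hf N)).
    by rewrite /e mulrC divfK// /z mulrBr raddfB.
  lra.
have [G GP [Gr FG]] : exists2 G, ProperFilter G & exists r,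
    G --> (r : weak (linfty R J)) /\ (linfty_row hf \o i @ \oo) `<=` G.
  have [|r [_ rcl]] := cpt (linfty_row hf \o i @ \oo) _.
    by exists 0%N => // m _; apply: subset_closure; exists (i m).
  move: rcl; rewrite cluster_cvgE => -[G GP [Gr FG]].
  by exists G => //; exists r.
(* [Gr] is a weak cluster point of the sequence of rows [i m], and the limit of the finer filter
   [G]. *)
case: FG => Gr' FG.
have [W [WU Woo]] := @ultraFilterLemma _ \oo eventually_filter.
have WP := @ultra_proper _ _ WU.
have [psi psiC psiP] := @real_form_ultralimit _ _ W (fun k => theta (nu k)) _ WU
  (fun k => thetaC (nu k)).
have GF : Filter G by exact: _.
have Gtail k : G [set u | exists2 m, (k <= m)%N & u = linfty_row hf (i m)].
  by apply: FG; exists k => // m /= km; exists m.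
(* Here k goes to infinity first, with m fixed, and then the rows go to [Gr]. *)
have psi_le : psi Gr <= e.
  have le_near : \forall u \near G, [set y | y <= e] (psi u).
    apply: filterS (Gtail 0%N) => _ [m _ ->].
    have le_near : \forall k \near W,
        [set y | y <= e] (theta (nu k) (linfty_row hf (i m))).
      by apply: Woo; exists m.+1 => // k /= mk; exact: nui_le.
    exact: (closed_cvg _ (@closed_le R e) le_near _ (psiP _)).
  exact: (closed_cvg _ (@closed_le R e) le_near _ (real_form_cvg psiC GF Gr')).
(* The opposite order of limits: the rows first, with k fixed. *)
have psi_ge : 2 * e <= psi Gr.
  have ge_near : \forall k \near W, [set y | 2 * e <= y] (theta (nu k) Gr).
    apply: nearW => k.
    have ge_near : \forall u \near G, [set y | 2 * e <= y] (theta (nu k) u).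
      by apply: filterS (Gtail k) => _ [m km ->]; exact: nui_ge.
    exact: (closed_cvg _ (@closed_ge R (2 * e)) ge_near _
      (real_form_cvg (thetaC (nu k)) GF Gr')).
  exact: (closed_cvg _ (@closed_ge R (2 * e)) ge_near _ (psiP _)).
by move: (le_trans psi_ge psi_le); lra.
Qed.

End fubini.

(** * Weak compactness of the rows of an extended function *)

(** Point evaluations are norm-continuous forms and separate the elements of l^oo. *)
Lemma hausdorff_weak_linfty (R : realType) (K : Type) :
  hausdorff_space (weak (linfty R K)).
Proof.
move=> u v; rewrite cluster_cvgE => -[G GP [Gv uG]].
have GF : Filter G by exact: _.
have Gu : G --> (u : weak (linfty R K)) by [].
apply: linfty_eqP => x.
pose ev (w : linfty R K) : R[i] := w x.
have evl : scalar ev by [].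
pose phi : {scalar linfty R K} :=
  HB.pack ev (GRing.isLinear.Build R[i] _ R[i] *%R ev evl).
have phic : continuous phi.
  move=> w; apply/(@cvgrPdist_lt _ _ _ (nbhs w) (nbhs_filter _)) => e e0.
  near=> w'; rewrite -linearB; apply: (@le_lt_trans _ _ `|w - w'|).
    exact: (linfty_norm_ub (w - w') x).
  by near: w'; apply: cvgr_dist_lt.
have evG w : G --> (w : weak (linfty R K)) -> ev @ G --> ev w.
  by move=> /cvg_weak Gw; exact: (Gw phi phic).
exact: (cvg_unique (@norm_hausdorff _ R[i]^o) (evG _ Gu) (evG _ Gv)).
Unshelve. all: by end_near. Qed.

Lemma cvg_in_set (T : Type) (E S : topologicalType) (A : set E) (h : E -> S)
    (W : set_system T) (y : T -> E) (x : E) : Filter W ->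
  {within A, continuous h} -> A x -> (forall t, A (y t)) -> y @ W --> x ->
  h \o y @ W --> h x.
Proof.
move=> WF /subspace_continuousP hc Ax Ay yx U /(hc _ Ax) hU.
apply: (@filterS _ W WF _ _ _ (yx _ hU)) => t /=; apply; exact: Ay.
Qed.

Section separately_continuous_extension.
Variable R : realType.
Local Open Scope complex_scope.

Lemma within_compact_bounded (E : topologicalType) (A : set E) (h : E -> R[i]) :
  compact A -> {within A, continuous h} ->
  exists2 c : R, 0 <= c & forall x, A x -> `|h x| <= c%:C.
Proof.
move=> cA hc.
have bnd (p : R[i] -> R) : continuous p ->
    exists c, forall x, A x -> `|p (h x)| <= c.
  move=> pc; have phc : {within A, continuous (p \o h)}.
    by move=> x; exact: (cvg_comp _ _ (hc x) (pc (h x))).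
  have [M [_ MP]] := compact_bounded (continuous_compact phc cA).
  exists (M + 1) => x Ax; apply: (MP (M + 1)); first by rewrite ltrDl.
  by exists x.
have [c cP] := bnd _ (@continuous_Re R).
have [d dP] := bnd _ (@continuous_Im R).
exists (`|c| + `|d|); first by rewrite addr_ge0.
move=> x Ax; rewrite [h x]complexE (le_trans (ler_normD _ _))// normrM.
rewrite normci mul1r.
rewrite !norm_real_complex -rmorphD lecR lerD//.
  by rewrite (le_trans (cP _ Ax))// ler_norm.
by rewrite (le_trans (dP _ Ax))// ler_norm.
Qed.

Lemma convex_set_combination (V : lmodType R) (C : set V) (t : R) (x y : V) :
  convex_set C -> 0 <= t <= 1 -> C x -> C y -> C (t *: x + (1 - t) *: y).
Proof.
move=> cC /andP[t0 t1] Cx Cy.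
have ti : Itv.spec (Itv.num_sem (R:=R)) (Itv.Real `[0%Z, 1%Z]) t.
  by rewrite /= /Itv.num_sem /= in_itv /= t0 t1 ger0_real.
exact: set_mem (cC _ _ (Itv.mk ti) (mem_set Cx) (mem_set Cy)).
Qed.

(** One barycentre [z] serves all affine functions at once. The induction, started at [y0], merges
    the next point with the previous barycentre in proportion to their masses. *)
Lemma affine_barycenter (F : tvsType R) (B : set F) (y0 : F) (T : Type)
    (r : seq T) (lam : T -> R) (y : T -> F) :
  convex_set B -> B y0 -> (forall t, B (y t)) -> (forall t, 0 <= lam t) ->
  exists2 z, B z & forall h : F -> R[i], affine_on B h ->
    \sum_(t <- r) (lam t)%:C * h (y t) = (\sum_(t <- r) lam t)%:C * h z.
Proof.
move=> cB By0 By lam0; elim: r => [|t r [z Bz zP]].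
  by exists y0 => // h _; rewrite !big_nil mul0r.
pose s := \sum_(t <- r) lam t.
have s0 : 0 <= s by exact: sumr_ge0.
have [st0|st0] := eqVneq (lam t + s) 0.
  exists z => // h hB; rewrite !big_cons zP// -/s st0 mul0r.
  have /eqP := st0; rewrite paddr_eq0// => /andP[/eqP -> /eqP ->].
  by rewrite !mul0r addr0.
have st_gt0 : 0 < lam t + s by rewrite lt_neqAle eq_sym st0 addr_ge0.
have [p pE] : {p : R | p = lam t / (lam t + s)} by eexists.
have p0 : 0 <= p by rewrite pE divr_ge0// ltW.
have p1 : p <= 1 by rewrite pE ler_pdivrMr// mul1r lerDl.
exists (p *: y t + (1 - p) *: z).
  by apply: convex_set_combination => //; rewrite p0.
move=> h hB; rewrite !big_cons zP// -/s hB ?p0//.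
rewrite mulrDr !mulrA -!rmorphM; congr (_%:C * _ + _%:C * _).
  by rewrite pE mulrCA divff// mulr1.
by rewrite mulrBr mulr1 pE mulrCA divff// mulr1 addrAC subrr add0r.
Qed.

(* The four parts [+Re], [-Re], [+Im], [-Im]. *)
Definition signed_part (i j : bool) (z : R[i]) : R :=
  (-1) ^+ j * (if i then complex.Re z else complex.Im z).

Lemma signed_partD i j : {morph signed_part i j : z w / z + w}.
Proof.
by move=> z w; rewrite /signed_part -mulrDr; case: i; rewrite raddfD.
Qed.

Lemma signed_partZ i j (a : R) z :
  signed_part i j (a%:C * z) = a * signed_part i j z.
Proof. by case: z => p q; rewrite /signed_part; case: i => /=; ring. Qed.

Lemma continuous_signed_part i j : continuous (signed_part i j).
Proof.
move=> z; have FF := nbhs_filter z.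
case: i; first exact: (@cvgMl_tmp _ _ (nbhs z) FF _ _ _ (@continuous_Re R z)).
exact: (@cvgMl_tmp _ _ (nbhs z) FF _ _ _ (@continuous_Im R z)).
Qed.

Lemma cvg_signed_part i j (T : Type) (W : set_system T) (h : T -> R[i])
    (z : R[i]) :
  h @ W --> z -> (fun t => signed_part i j (h t)) @ W --> signed_part i j z.
Proof. by move=> hz; exact: cvg_comp hz (@continuous_signed_part i j z). Qed.

(** Coefficients are split into positive and negative parts: each of the four inner sums then has
    nonnegative weights, as [affine_barycenter] demands. *)
Lemma simple_form_signed_parts (J : Type) (T : finType) (al be : T -> R)
    (s : T -> J) (u : linfty R J) :
  simple_form al be s u = \sum_(i : bool) \sum_(j : bool) signed_part i j
    (\sum_t (Num.max ((-1) ^+ j * (if i then al t else be t)) 0)%:C * u (s t)).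
Proof.
have part_sum i j (z : T -> R[i]) :
    signed_part i j (\sum_t z t) = \sum_t signed_part i j (z t).
  apply: (big_morph _ (signed_partD i j)).
  by rewrite /signed_part; case: i; rewrite mulr0.
rewrite big_bool !big_bool /= !part_sum -!big_split; apply: eq_bigr => t _ /=.
have maxE (x : R) : Num.max x 0 - Num.max (- x) 0 = x.
  by rewrite /Num.max; case: ltP => x0; case: ltP => x1; lra.
rewrite !signed_partZ /signed_part !expr0 !expr1 !mul1r !mulN1r.
by rewrite -{1}[al t]maxE -{1}[be t]maxE; ring.
Qed.

Variables (I J : Type) (E F : tvsType R) (A : set E) (B : set F).
Variables (b : J -> F) (g : E * F -> R[i]).
Hypotheses (cA : compact A) (cB : compact B) (cvxB : convex_set B).
Hypotheses (Bb : forall j, B (b j)).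
Hypotheses (g_cont : separately_continuous_on A B g).
Hypotheses (g_aff : separately_affine_on A B g).

(** Total in [x]: off [A], where nothing bounds [g], the value may be the default 0. *)
Definition slice (x : E) : linfty R J := linfty_of (fun j => g (x, b j)).

Lemma sliceE x j : A x -> slice x j = g (x, b j).
Proof.
move=> Ax; have [c _ gc] := within_compact_bounded cB (g_cont.2 x Ax).
by rewrite /slice (@linfty_ofE _ _ _ c)// => k; exact/gc/Bb.
Qed.

(** Four weights and four points stand for a combination of any length; this fixed number of
    parameters lets compactness act on them. *)
Definition signed_combination (q : bool -> bool -> R * F) (x : E) : R :=
  \sum_(i : bool) \sum_(j : bool)
    signed_part i j ((q i j).1%:C * g (x, (q i j).2)).

(** Barycentres in [B] replace the finite combinations. The weights are total masses, hence at most
    [C], and [q] does not depend on [x]. *)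
Lemma approx_slice (psi : linfty R J -> R) (C : R) (j0 : J)
    (us : seq (linfty R J)) (e : R) :
  real_form C psi -> 0 < e ->
  exists q : bool -> bool -> R * F,
    (forall i j, 0 <= (q i j).1 <= C /\ B (q i j).2) /\
    forall x, A x -> slice x \in us ->
      `|psi (slice x) - signed_combination q x| <= e.
Proof.
move=> psiC e0.
have [T [al [be [s [alC beC approx]]]]] := real_form_approx j0 us psiC e0.
pose lam (i j : bool) t := Num.max ((-1) ^+ j * (if i then al t else be t)) 0.
have lam0 i j t : 0 <= lam i j t by rewrite le_max lexx orbT.
have lamC i j : \sum_t lam i j t <= C.
  apply: (@le_trans _ _ (\sum_t `|if i then al t else be t|)); last by case: i.
  apply: ler_sum => t _; rewrite ge_max normr_ge0 andbT.
  by rewrite (le_trans (ler_norm _))// normrM normrX normrN1 expr1n mul1r.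
have /choice[z zP] : forall ij : bool * bool, exists z, B z /\
    forall h : F -> R[i], affine_on B h ->
    \sum_t (lam ij.1 ij.2 t)%:C * h (b (s t)) =
      (\sum_t lam ij.1 ij.2 t)%:C * h z.
  move=> ij; have [z Bz zP] := affine_barycenter (index_enum T) cvxB (Bb j0)
    (fun t => Bb (s t)) (lam0 ij.1 ij.2).
  by exists z.
exists (fun i j => (\sum_t lam i j t, z (i, j))); split.
  by move=> i j /=; rewrite sumr_ge0// lamC; split=> //; have [] := zP (i, j).
move=> x Ax /approx; rewrite simple_form_signed_parts.
congr (`|_ - _| <= _); apply: eq_bigr => i _; apply: eq_bigr => j _.
congr signed_part.
have [_ /(_ (fun y => g (x, y)) (g_aff.2 x Ax)) /= <-] := zP (i, j).
by apply: eq_bigr => t _; rewrite sliceE.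
Qed.

(** For ever longer lists and smaller errors, the parameters of the approximants stay in the compact
    sets [0, C] and [B]. Their limit along an ultrafilter is exact, by continuity of g(x, .). *)
Lemma real_form_slice (psi : linfty R J -> R) (C : R) (j0 : J) :
  real_form C psi ->
  exists2 q : bool -> bool -> R * F, (forall i j, B (q i j).2) &
    forall x, A x -> psi (slice x) = signed_combination q x.
Proof.
move=> psiC.
have /choice[q qP] : forall p : seq (linfty R J) * nat,
    exists q : bool -> bool -> R * F,
    (forall i j, 0 <= (q i j).1 <= C /\ B (q i j).2) /\
    forall x, A x -> slice x \in p.1 ->
      `|psi (slice x) - signed_combination q x| <= p.2.+1%:R^-1.
  by move=> p; apply: approx_slice => //; rewrite invr_gt0.
pose tail (p : seq (linfty R J) * nat) :=
  [set p' : seq (linfty R J) * nat | {subset p.1 <= p'.1} /\ (p.2 <= p'.2)%N].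
have tailP : ProperFilter (filter_from setT tail).
  apply: filter_from_proper => [|p _]; last by exists p; split.
  apply: filter_fromT_filter; first by exists ([::], 0%N).
  move=> p p'; exists (p.1 ++ p'.1, maxn p.2 p'.2) => p'' [/= s1 s2].
  move: s2; rewrite geq_max => /andP[s2 s2']; split; split=> // u up; apply: s1.
    by rewrite mem_cat up.
  by rewrite mem_cat up orbT.
have [W [WU Wtail]] := ultraFilterLemma tailP.
have WP := @ultra_proper _ _ WU.
have /choice[l lP] : forall ij : bool * bool, exists l : R * F,
    [/\ B l.2, (fun p => (q p ij.1 ij.2).1) @ W --> l.1 &
        (fun p => (q p ij.1 ij.2).2) @ W --> l.2].
  move=> [i j] /=.
  have [|t tl] := @ultra_bounded_cvg R _ W (fun p => (q p i j).1) C WU.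
    by move=> p; have [/(_ i j)[/andP[q0 qC] _] _] := qP p; rewrite ger0_norm.
  have [|y By yl] := @ultra_compact_cvg _ _ W B (fun p => (q p i j).2) WU cB.
    by apply: nearW => p; have [/(_ i j)[_ ]] := qP p.
  by exists (t, y).
exists (fun i j => l (i, j)); first by move=> i j; have [] := lP (i, j).
move=> x Ax.
have to_comb : (fun p => signed_combination (q p) x) @ W -->
    signed_combination (fun i j => l (i, j)) x.
  apply: cvg_big => [|i _]; first exact: add_continuous.
  apply: cvg_big => [|j _]; first exact: add_continuous.
  have [Bl tl yl] := lP (i, j).
  have gl : (fun p => g (x, (q p i j).2)) @ W --> g (x, (l (i, j)).2).
    apply: (cvg_in_set _ (g_cont.2 x Ax) Bl _ yl) => p.
    by have [/(_ i j)[_ ]] := qP p.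
  apply: cvg_signed_part.
  exact: (cvgM (cvg_comp _ _ tl (@continuous_real_complex R _)) gl).
have to_psi : (fun p => signed_combination (q p) x) @ W --> psi (slice x).
  apply/cvgrPdist_le => e e0.
  apply: Wtail; exists ([:: slice x], Num.truncn e^-1) => // p [/= sx pe].
  have [_ /(_ x Ax) H] := qP p; apply: le_trans (H _) _.
    exact/sx/mem_head.
  rewrite -[leRHS]invrK lef_pV2 ?posrE ?invr_gt0//.
  by rewrite ltW// (lt_le_trans (truncnS_gt _))// ler_nat.
exact: (cvg_unique (@Rhausdorff R) to_psi to_comb).
Qed.

(** Only four fixed points y of [B] are involved, and each g(., y) is continuous on [A]. *)
Lemma real_form_slice_continuous (psi : linfty R J -> R) (C : R) :
  real_form C psi -> {within A, continuous (psi \o slice)}.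
Proof.
(* For empty [J] there is no base point, but all slices coincide with 0. *)
move=> psiC; have [[j0 _]|nJ] := pselect (exists j : J, True); last first.
  have -> : psi \o slice = cst (psi 0).
    apply/funext => x /=; congr psi; apply: linfty_eqP => j.
    by case: nJ; exists j.
  by move=> x; exact: cvg_cst.
have [q Bq qE] := real_form_slice j0 psiC.
apply: (@subspace_eq_continuous _ _ _ (signed_combination q)).
  by move=> x /set_mem Ax; exact/esym/qE.
apply/subspace_continuousP => x Ax.
apply: cvg_big => [|i _]; first exact: add_continuous.
apply: cvg_big => [|j _]; first exact: add_continuous.
apply: cvg_signed_part.
have /subspace_continuousP/(_ x Ax) gl := g_cont.1 _ (Bq i j).
exact: (cvgMl_tmp gl).
Qed.

Lemma slice_weakly_continuous :
  {within A, continuous (slice : E -> weak (linfty R J))}.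
Proof.
apply/subspace_continuousP => x Ax.
apply/cvg_weak => phi phic.
have [D phiD] := scalar_continuous_bounded phic.
apply: cvg_complex.
  have [C psiC] := real_form_Re 1 phiD.
  have psiE : (fun u => complex.Re (1 * phi u)) = (fun u => complex.Re (phi u)).
    by apply/funext => u; rewrite mul1r.
  rewrite psiE in psiC.
  by have /subspace_continuousP := real_form_slice_continuous psiC; apply.
have [C psiC] := real_form_Re (- 'i) phiD.
have psiE : (fun u => complex.Re (- 'i * phi u)) =
    (fun u => complex.Im (phi u)).
  by apply/funext => u; rewrite ImE_Re.
rewrite psiE in psiC.
by have /subspace_continuousP := real_form_slice_continuous psiC; apply.
Qed.

Lemma compact_slices : compact (slice @` A : set (weak (linfty R J))).
Proof. exact: continuous_compact slice_weakly_continuous cA. Qed.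

End separately_continuous_extension.

(** The rows are the slices at the points [a i]; the compact set of all slices is closed, the weak
    topology being Hausdorff, so it contains their closure. *)
Lemma rows_of_extension (R : realType) (I J : Type) (f : I * J -> R[i])
    (hf : bounded_fun f) (E F : tvsType R) (A : set E) (B : set F)
    (a : I -> E) (b : J -> F) (g : E * F -> R[i]) :
  compact A -> compact B -> convex_set B ->
  (forall i, A (a i)) -> (forall j, B (b j)) ->
  separately_continuous_on A B g -> separately_affine_on A B g ->
  (forall i j, g (a i, b j) = f (i, j)) ->
  relatively_weakly_compact (range (linfty_row hf)).
Proof.
move=> cA cB cvxB Aa Bb g_cont g_aff gf.
have cK := compact_slices cA cB cvxB Bb g_cont g_aff.
have clK := compact_closed (@hausdorff_weak_linfty R J) cK.
apply: (subclosed_compact (@closed_closure _ _) cK).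
apply: subset_trans (closureS _) clK => _ [i _ <-]; exists (a i) => //.
by apply: linfty_eqP => j; rewrite (sliceE cB Bb g_cont)// gf.
Qed.

(** * The compact convex set of means *)

(** An alias on which the product topology and the pointwise linear operations are combined into one
    locally convex space. *)
Definition ptws_space (R : realType) (K : choiceType) : Type := {ptws K -> R^o}.

HB.instance Definition _ (R : realType) (K : choiceType) :=
  Uniform.copy (ptws_space R K) {ptws K -> R^o}.
HB.instance Definition _ (R : realType) (K : choiceType) :=
  GRing.Lmodule.copy (ptws_space R K) (K -> R^o).

Section ptws_tvs.
Variables (R : realType) (K : choiceType).
Local Notation P := (ptws_space R K).

Lemma cvg_ptws (F : set_system P) (f : P) : Filter F ->
  F --> f <-> (forall k, (fun h : P => h k) @ F --> (f k : R^o)).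
Proof.
move=> FF; split=> [Ff k|Ff].
  by have /cvg_sup/(_ k)/cvg_initial := Ff; exact.
by apply/cvg_sup => k; apply/cvg_initial/Ff.
Qed.

Lemma ptws_eval_continuous (k : K) : continuous (fun h : P => h k : R^o).
Proof.
move=> f; have ff : nbhs f --> f by [].
exact: ((@cvg_ptws (nbhs f) f (nbhs_filter f)).1 ff k).
Qed.

Lemma ptws_add_continuous : continuous (fun x : P * P => x.1 + x.2).
Proof.
move=> [f g]; pose add (x : P * P) : P := x.1 + x.2.
have FF : Filter (add @ nbhs ((f, g) : P * P)) by exact: fmap_filter.
apply: (@cvg_ptws _ (add (f, g)) FF).2 => k.
have fk : (fun x : P * P => x.1 k : R^o) @ nbhs ((f, g) : P * P) -->
    (f k : R^o).
  exact: (cvg_comp _ _ (@cvg_fst _ _ (nbhs f) (nbhs g) _)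
    (@ptws_eval_continuous k f)).
have gk : (fun x : P * P => x.2 k : R^o) @ nbhs ((f, g) : P * P) -->
    (g k : R^o).
  exact: (cvg_comp _ _ (@cvg_snd _ _ (nbhs f) (nbhs g) _)
    (@ptws_eval_continuous k g)).
exact: (cvgD fk gk).
Qed.

Lemma ptws_scale_continuous : continuous (fun z : R^o * P => z.1 *: z.2).
Proof.
move=> [a g]; pose scale (z : R^o * P) : P := z.1 *: z.2.
have FF : Filter (scale @ nbhs ((a, g) : R^o * P)) by exact: fmap_filter.
apply: (@cvg_ptws _ (scale (a, g)) FF).2 => k.
have ak : (fun z : R^o * P => z.1) @ nbhs ((a, g) : R^o * P) --> a.
  exact: (@cvg_fst _ _ (nbhs a) (nbhs g) _).
have gk : (fun z : R^o * P => z.2 k : R^o) @ nbhs ((a, g) : R^o * P) -->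
    (g k : R^o).
  exact: (cvg_comp _ _ (@cvg_snd _ _ (nbhs a) (nbhs g) _)
    (@ptws_eval_continuous k g)).
exact: (cvgM ak gk).
Qed.

(** Basic open sets of the product topology; their convexity yields local convexity. *)
Definition ptws_box (f : P) (D : {fset K}) (e : R) : set P :=
  [set h | forall k, k \in D -> `|f k - h k| < e].

Lemma convex_ptws_box f D e : convex_set (ptws_box f D e).
Proof.
apply/convex_setW => h h' /set_mem hD /set_mem hD' p p0 p1.
apply/mem_set => k kD /=.
suff : `|p%:num * (f k - h k) + (1 - p%:num) * (f k - h' k)| < e.
  congr (`|_| < e).
  transitivity (f k - (p%:num * h k + (1 - p%:num) * h' k)) => //.
  by ring.
rewrite (le_lt_trans (ler_normD _ _))// !normrM.
have q0 : 0 < 1 - p%:num by rewrite subr_gt0.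
rewrite (gtr0_norm p0) (gtr0_norm q0).
have -> : e = p%:num * e + (1 - p%:num) * e by ring.
by rewrite ltrD// ltr_pM2l// ?hD// ?hD'.
Qed.

Lemma open_ptws_box f D e : open (ptws_box f D e).
Proof.
rewrite openE => h hD; rewrite /interior.
have -> : ptws_box f D e = \bigcap_(k in [set` D]) [set h' | `|f k - h' k| < e].
  by apply/seteqP; split=> h' hh k; apply: hh.
apply: filter_bigI => k kD.
have := @ptws_eval_continuous k h [set y : R^o | `|f k - y| < e]; apply.
have : open [set y : R^o | `|f k - y| < e].
  have -> : [set y : R^o | `|f k - y| < e] = ball (f k : R^o) e by [].
  exact: ball_open.
by rewrite openE => /(_ (h k)); apply; exact: hD.
Qed.

Lemma ptws_locally_convex : exists2 B : set_system P,
  (forall b, b \in B -> convex_set b) & basis B.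
Proof.
exists [set U | exists f D e, U = ptws_box f D e].
  by move=> U /set_mem[f [D [e ->]]]; exact: convex_ptws_box.
split; first by move=> _ [f [D [e ->]]]; exact: open_ptws_box.
move=> f V fV.
(* The boxes centred at [f] generate a filter converging to [f], so every neighbourhood of [f]
   contains one of them. *)
pose G := filter_from [set De : {fset K} * R | 0 < De.2]
  (fun De => ptws_box f De.1 De.2).
have GF : Filter G.
  apply: filter_from_filter; first by exists (fset0, 1) => /=.
  move=> [D e] [D' e'] /= e0 e'0; exists ((D `|` D')%fset, Num.min e e') => /=.
    by rewrite lt_min e0.
  move=> h hDD'; split=> k kD.
    by have := hDD' k; rewrite inE kD lt_min => /(_ isT)/andP[].
  by have := hDD' k; rewrite inE kD orbT lt_min => /(_ isT)/andP[].
have : G --> f.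
  apply: (@cvg_ptws _ _ GF).2 => k; apply/cvgrPdist_lt => e e0.
  by exists ([fset k]%fset, e) => //= h; apply; rewrite inE.
move=> /(_ V fV)[[D e] /= e0 DeV]; exists (ptws_box f D e) => //.
by split; [exists f, D, e|move=> k _; rewrite subrr normr0].
Qed.

End ptws_tvs.

HB.instance Definition _ (R : realType) (K : choiceType) :=
  PreTopologicalNmodule_isTopologicalNmodule.Build (ptws_space R K)
    (@ptws_add_continuous R K).
HB.instance Definition _ (R : realType) (K : choiceType) :=
  TopologicalNmodule_isTopologicalLmodule.Build R (ptws_space R K)
    (@ptws_scale_continuous R K).
HB.instance Definition _ (R : realType) (K : choiceType) :=
  Uniform_isTvs.Build R (ptws_space R K) (@ptws_locally_convex R K).

Lemma hausdorff_ptws (R : realType) (K : choiceType) :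
  hausdorff_space (ptws_space R K).
Proof.
move=> f g; rewrite cluster_cvgE => -[G GP [Gg fG]].
have GF : Filter G by exact: _.
have Gf : G --> (f : ptws_space R K) by [].
apply/funext => k.
exact: (cvg_unique (@Rhausdorff R) ((cvg_ptws _ GF).1 Gf k)
  ((cvg_ptws _ GF).1 Gg k)).
Qed.

Lemma compact_ptws_box (R : realType) (K : choiceType) (c : K -> R) :
  compact [set f : ptws_space R K | forall k, `|f k| <= c k].
Proof.
have := @tychonoff K (fun _ => R^o) (fun k => `[- c k, c k]%classic)
  (fun k => @segment_compact R _ _).
congr compact; apply/seteqP.
by split=> f fc k; have := fc k; rewrite /= in_itv/= -ler_norml.
Qed.

Lemma near_eq_lim (R : realType) (T : Type) (G : set_system T)
    (GP : ProperFilter G) (f1 f2 : T -> R) (l1 l2 : R) :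
  f1 @ G --> l1 -> f2 @ G --> l2 -> (\forall t \near G, f1 t = f2 t) -> l1 = l2.
Proof.
move=> fl1 fl2 f12; have fl1' : f1 @ G --> l2.
  apply: cvg_trans fl2; apply: near_eq_cvg.
  by apply: filterS f12 => t ->.
exact: (cvg_unique (@Rhausdorff R) fl1 fl1').
Qed.

Section mean_space.
Variables (R : realType) (I : Type).
Local Open Scope complex_scope.
Local Notation L := (linfty R I).
Local Notation P := (ptws_space R L).

(* A mean is determined by its real part, see [complexified_mean]. *)
Definition mean_set : set P :=
  [set phi | exists M : mean R I, phi = (fun u => complex.Re (M u))].

Definition one_linfty : L := to_linfty (Defs.bounded_cst I (1 : R[i])).

(** Each condition concerns finitely many values of [phi] at a time, so convexity and closedness can
    be checked one by one. The condition on i u makes the complexified form real on real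
    functions. *)
Lemma mean_setP (phi : P) : mean_set phi <->
  [/\ {morph phi : u v / (u + v : L) >-> u + v},
      forall (t : R) (u : L), phi (t%:C *: u) = t * phi u,
      forall u : L, (forall x, 0 <= u x) -> 0 <= phi u,
      forall u : L, (forall x, u x \is Num.real) -> phi ('i *: u) = 0 &
      phi one_linfty = 1].
Proof.
split=> [[M ->]|[phiD phiZ phi_ge0 phi_real phi1]].
  split.
  - by move=> u v; rewrite linearD raddfD.
  - move=> t u; rewrite linearZ/=; case: (M u) => p q /=.
    by rewrite mul0r subr0.
  - by move=> u /(mean_ge0 M); rewrite lecE => /andP[].
  - move=> u /(mean_real M)/complex_realP[k Mk]; rewrite linearZ/= Mk /=.
    by rewrite mul0r mulr0 subr0.
  - by rewrite (mean1 M).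
have [F FE] := complexify phiD phiZ.
have F_real (u : L) : (forall x, u x \is Num.real) -> F u = (phi u)%:C.
  by move=> ur; rewrite FE phi_real// mulr0 subr0.
have F_ge0 (u : L) : (forall x, 0 <= u x) -> 0 <= F u.
  by move=> u0; rewrite F_real ?lecR ?phi_ge0// => x; exact: ger0_real.
have F1 : F (to_linfty (Defs.bounded_cst I (1 : R[i]))) = 1.
  by rewrite F_real ?phi1// => x; exact: real1.
exists (Mean F_ge0 F1); apply/funext => u /=.
by rewrite FE /= !(mul0r, mulr0, mul1r, subr0, oppr0, addr0).
Qed.

Lemma convex_mean_set : convex_set mean_set.
Proof.
move=> phi psi p.
move=> /set_mem/mean_setP[pD pZ p0 pr p1] /set_mem/mean_setP[qD qZ q0 qr q1].
have pn0 : 0 <= p%:num :> R by [].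
have pn1 : 0 <= 1 - p%:num :> R by rewrite subr_ge0.
suff : mean_set (fun u => p%:num * phi u + (1 - p%:num) * psi u).
  by move/mem_set.
apply/mean_setP; split.
- by move=> u v; rewrite pD qD; ring.
- by move=> t u; rewrite pZ qZ; ring.
- by move=> u u0; apply: addr_ge0; apply: mulr_ge0 => //; [exact: p0|exact: q0].
- by move=> u ur; rewrite pr// qr// !mulr0 addr0.
- by rewrite p1 q1; ring.
Qed.

Lemma closed_mean_set : closed mean_set.
Proof.
move=> phi; rewrite closureEcvg => -[G GP [Gphi Gmean]].
have GF : Filter G by exact: _.
have ev u : (fun h : P => h u) @ G --> phi u.
  exact: ((cvg_ptws _ GF).1 Gphi u).
have Gm : G mean_set by exact: Gmean.
apply/mean_setP; split.
- move=> u v; apply: (near_eq_lim GP (ev _) (cvgD (ev u) (ev v))).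
  by apply: filterS Gm => h /mean_setP[+ _ _ _ _]; apply.
- move=> t u; apply: (near_eq_lim GP (ev _) (cvgMl_tmp (a := t) (ev u))).
  by apply: filterS Gm => h /mean_setP[_ + _ _ _]; apply.
- move=> u u0.
  have ge_near : \forall h \near G, [set y | 0 <= y] (h u : R).
    by apply: filterS Gm => h /mean_setP[_ _ + _ _]; apply.
  exact: (closed_cvg _ (@closed_ge R 0) ge_near _ (ev u)).
- move=> u ur; apply: (near_eq_lim GP (ev _) (cvg_cst 0)).
  by apply: filterS Gm => h /mean_setP[_ _ _ + _]; apply.
- apply: (near_eq_lim GP (ev one_linfty) (cvg_cst (1 : R))).
  by apply: filterS Gm => h /mean_setP[_ _ _ _].
Qed.

(** Tychonoff: the bound of |M u| by twice the norm of [u] places the closed [mean_set] in a compact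
    product of segments. *)
Lemma compact_mean_set : compact mean_set.
Proof.
have cpt := @compact_ptws_box R L (fun u =>
  complex.Re (linfty_norm u) + complex.Re (linfty_norm u)).
apply: (subclosed_compact closed_mean_set cpt) => _ [M ->] u.
rewrite -lecR (le_trans (normc_ge_Re _))//; apply: mean_bounded => x.
exact: (linfty_norm_ub u x).
Qed.

Definition dirac_form (i : I) : P := fun u => complex.Re (u i).

Lemma dirac_form_mean i : mean_set (dirac_form i).
Proof.
apply/mean_setP; split.
- by move=> u v; rewrite /dirac_form linftyD raddfD.
- move=> t u; rewrite /dirac_form linftyZ; case: (u i) => p q /=.
  by rewrite mul0r subr0.
- by move=> u /(_ i); rewrite /dirac_form lecE => /andP[].
- move=> u /(_ i)/complex_realP[k uk]; rewrite /dirac_form linftyZ uk /=.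
  by rewrite mul0r mulr0 subr0.
- by [].
Qed.

Lemma dirac_form_inj : injective dirac_form.
Proof.
move=> i j ij; pose u : L := linfty_of (fun x => (\1_[set i] x)%:C).
have uE x : u x = (\1_[set i] x : R)%:C.
  exact: (linfty_of_realE x (@bounded_real_indic R I [set i])).
have := congr1 (fun phi : P => phi u) ij.
rewrite /dirac_form !uE /= !indicE mem_set//.
have [/set_mem -> //|_ /eqP] := boolP (j \in _).
by rewrite oner_eq0.
Qed.

(** Recovers a mean from its real part by a formula that is continuous and affine in [phi] on the
    whole space. *)
Definition complexified (phi : P) (u : L) : R[i] :=
  (phi u)%:C - 'i * (phi ('i *: u))%:C.

Lemma complexified_mean (M : mean R I) u :
  complexified (fun v => complex.Re (M v)) u = M u.
Proof.
rewrite /complexified linearZ/= {3}[M u]complexE; case: (M u) => p q /=.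
by rewrite mul0r mul1r sub0r rmorphN mulrN opprK.
Qed.

Lemma complexified_dirac i u : complexified (dirac_form i) u = u i.
Proof.
rewrite /complexified /dirac_form linftyZ {3}[u i]complexE.
by case: (u i) => p q /=; rewrite mul0r mul1r sub0r rmorphN mulrN opprK.
Qed.

Lemma continuous_complexified u : continuous (complexified^~ u).
Proof.
move=> phi; have phi_nbhs : nbhs phi --> phi by [].
have ev v := (cvg_ptws phi (nbhs_filter phi)).1 phi_nbhs v.
have evC v : (fun h : P => (h v)%:C) @ nbhs phi --> (phi v)%:C.
  exact: (cvg_comp _ _ (ev v) (@continuous_real_complex R _)).
exact: (cvgB (evC u) (cvgMl_tmp (evC ('i *: u)))).
Qed.

Lemma complexified_affine (t : R) (phi psi : P) u :
  complexified (t *: phi + (1 - t) *: psi) u =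
    t%:C * complexified phi u + (1 - t)%:C * complexified psi u.
Proof.
rewrite /complexified.
have E v : (t *: phi + (1 - t) *: psi) v = t * phi v + (1 - t) * psi v by [].
rewrite !E; apply/eqP; rewrite eq_complex /=.
by apply/andP; split; apply/eqP; ring.
Qed.

End mean_space.

(** * The extension of [f] to pairs of means *)

Section mean_extension.
Variables (R : realType) (I J : Type) (f : I * J -> R[i]) (hf : bounded_fun f).
Hypothesis fubini : forall (M : mean R I) (N : mean R J),
  N (mean_col hf M) = M (mean_row hf N).

Definition mean_extension
    (p : ptws_space R (linfty R I) * ptws_space R (linfty R J)) : R[i] :=
  complexified p.2 (linfty_of (fun j => complexified p.1 (linfty_col hf j))).

(** The exchange property lets either variable take the outer position, in which continuity and
    affinity are evident. *)
Lemma mean_extension_swap phi psi : mean_set phi -> mean_set psi ->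
  mean_extension (phi, psi) =
    complexified phi (linfty_of (fun i => complexified psi (linfty_row hf i))).
Proof.
move=> [M ->] [N ->]; rewrite /mean_extension /= !complexified_mean.
have -> : linfty_of (fun j =>
    complexified (fun u => complex.Re (M u)) (linfty_col hf j)) = mean_col hf M.
  rewrite -[RHS](linfty_ofK (bounded_mean_col hf M)).
  by congr linfty_of; apply/funext => j; exact: complexified_mean.
have -> : linfty_of (fun i =>
    complexified (fun u => complex.Re (N u)) (linfty_row hf i)) = mean_row hf N.
  rewrite -[RHS](linfty_ofK (bounded_mean_row hf N)).
  by congr linfty_of; apply/funext => i; exact: complexified_mean.
exact: fubini.
Qed.

Lemma mean_extension_continuous :
  @separately_continuous_on R (ptws_space R (linfty R I))
    (ptws_space R (linfty R J)) (@mean_set R I) (@mean_set R J) mean_extension.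
Proof.
split=> [psi mpsi|phi mphi].
  apply: (@subspace_eq_continuous _ _ _ (fun phi =>
    complexified phi (linfty_of (fun i => complexified psi (linfty_row hf i))))).
    by move=> phi /set_mem mphi; exact/esym/mean_extension_swap.
  exact/continuous_subspaceT/continuous_complexified.
apply: continuous_subspaceT; rewrite /mean_extension /=.
exact: continuous_complexified.
Qed.

Lemma mean_extension_affine :
  @separately_affine_on R (ptws_space R (linfty R I))
    (ptws_space R (linfty R J)) (@mean_set R I) (@mean_set R J) mean_extension.
Proof.
split=> [psi mpsi|phi mphi] t x y t01 mx my; last exact: complexified_affine.
rewrite !mean_extension_swap//; first exact: complexified_affine.
exact: convex_set_combination (@convex_mean_set R I) t01 mx my.
Qed.

Lemma mean_extensionE i j :
  mean_extension (dirac_form i, dirac_form j) = f (i, j).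
Proof.
rewrite /mean_extension /= complexified_dirac.
have [c fc] := (bounded_complexP f).1 hf.
rewrite (@linfty_ofE _ _ _ c) ?complexified_dirac// => k.
by rewrite complexified_dirac; exact: fc.
Qed.

End mean_extension.

(** * Exchanging rows and columns *)

Section transpose.
Variables (R : realType) (I J : Type) (f : I * J -> R[i]) (hf : bounded_fun f).

Definition transpose (p : J * I) : R[i] := f (p.2, p.1).

Lemma bounded_transpose : bounded_fun transpose.
Proof.
have [c fc] := (bounded_complexP f).1 hf.
by apply/bounded_complexP; exists c => p; exact: fc.
Qed.

Lemma row_transpose : linfty_row bounded_transpose = linfty_col hf.
Proof. by apply/funext => j; exact: linfty_eqP. Qed.

Lemma col_transpose : linfty_col bounded_transpose = linfty_row hf.
Proof. by apply/funext => i; exact: linfty_eqP. Qed.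

Lemma mean_row_transpose (M : mean R I) :
  mean_row bounded_transpose M = mean_col hf M.
Proof.
by apply: linfty_eqP => j; rewrite -[LHS]/(M (linfty_row _ j)) row_transpose.
Qed.

Lemma mean_col_transpose (N : mean R J) :
  mean_col bounded_transpose N = mean_row hf N.
Proof.
by apply: linfty_eqP => i; rewrite -[LHS]/(N (linfty_col _ i)) col_transpose.
Qed.

End transpose.

(** Passes through the extension to means; isolated so as to apply to the transpose as well. *)
Lemma rows_of_fubini (R : realType) (I J : Type) (f : I * J -> R[i])
    (hf : bounded_fun f) :
  (forall (M : mean R I) (N : mean R J),
    N (mean_col hf M) = M (mean_row hf N)) ->
  relatively_weakly_compact (range (linfty_row hf)).
Proof.
move=> fubini.
apply: (rows_of_extension (@compact_mean_set R I) (@compact_mean_set R J)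
  (@convex_mean_set R J) (@dirac_form_mean R I) (@dirac_form_mean R J)
  (mean_extension_continuous fubini) (mean_extension_affine fubini)).
exact: mean_extensionE.
Qed.

Theorem theorem1 (R : realType) (I J : Type) (f : I * J -> R[i])
    (hf : bounded_fun f) :
  [<-> (* (i) *)
       forall (M : mean R I) (N : mean R J),
         N (mean_col hf M) = M (mean_row hf N);
       (* (ii) *)
       exists (E F : tvsType R) (A : set E) (B : set F)
              (a : I -> E) (b : J -> F) (g : E * F -> R[i]),
         [/\ [/\ hausdorff_space E, compact A & convex_set A],
             [/\ hausdorff_space F, compact B & convex_set B],
             [/\ injective a, injective b,
                 forall i, A (a i) & forall j, B (b j)],
             separately_continuous_on A B g /\ separately_affine_on A B g &
             forall i j, g (a i, b j) = f (i, j)];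
       (* (iii) *)
       relatively_weakly_compact (range (linfty_row hf));
       (* (iv) *)
       relatively_weakly_compact (range (linfty_col hf))].
Proof.
tfae.
- move=> fubini.
  exists (ptws_space R (linfty R I)), (ptws_space R (linfty R J)).
  exists (@mean_set R I), (@mean_set R J), (@dirac_form R I), (@dirac_form R J).
  exists (mean_extension hf); split.
  + split; last exact: convex_mean_set; last exact: compact_mean_set.
    exact: hausdorff_ptws.
  + split; last exact: convex_mean_set; last exact: compact_mean_set.
    exact: hausdorff_ptws.
  + split; [exact: dirac_form_inj|exact: dirac_form_inj| |].
      exact: dirac_form_mean.
    exact: dirac_form_mean.
  + split; [exact: mean_extension_continuous|exact: mean_extension_affine].
  + exact: mean_extensionE.
- move=> [E [F [A [B [a [b [g]]]]]]].
  move=> [[_ cA _] [_ cB cvxB] [_ _ Aa Bb] [g_cont g_aff] gf].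
  exact: (rows_of_extension cA cB cvxB Aa Bb g_cont g_aff gf).
(* Weakly compact rows give the exchange for [f], hence for its transpose, whose rows are the
   columns of [f]. *)
- move=> rows; rewrite -row_transpose; apply: rows_of_fubini => N M.
  rewrite mean_row_transpose mean_col_transpose; exact/esym/fubini_of_rows.
- rewrite -row_transpose => cols M N.
  rewrite -mean_row_transpose -(mean_col_transpose hf N).
  exact: (esym (fubini_of_rows cols N M)).
Qed.
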